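(* Let $\mathcal{B}=\{B_t\}_{t\in G}$ be a Fell bundle over a discrete group $G$ with unit $e$. If $\mathcal{B}$ is aperiodic, then $\mathcal{B}$ has the intersection property, i.e. every non-zero ideal in $C^*_r(\mathcal{B})$ has a non-zero intersection with $B_e$.
   Context: Ideals in $C^*$-algebras are closed and two-sided. A Fell bundle $\mathcal{B}=\{B_t\}_{t\in G}$ over a discrete group $G$ with unit $e$ is a collection of closed subspaces of a $C^*$-algebra such that $B_t^*=B_{t^{-1}}$ and $B_tB_s\subseteq B_{ts}$ for all $s,t\in G$; in particular $B_e$ is a $C^*$-algebra. The (external) direct sum $\bigoplus_{t\in G}B_t$ is a $*$-algebra. Among the $C^*$-norms on it satisfying $\|a_e\|\le\|\sum_t a_t\|$ for all $\sum_t a_t\in\bigoplus_t B_t$ ($a_t\in B_t$) there is a minimal one; the corresponding completion is the reduced cross-sectional algebra $C^*_r(\mathcal{B})$. $\mathcal{B}$ is aperiodic if for each $t\in G\setminus\{e\}$, each $b_t\in B_t$ and every non-zero hereditary $C^*$-subalgebra $D$ of $B_e$, $\inf\{\|ab_ta\|: a\in D^+,\ \|a\|=1\}=0$. *)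

(* Defs.v *)
From HB Require Import structures.
From mathcomp Require Import all_boot all_order all_algebra.
From mathcomp Require Import all_classical all_reals all_analysis.
From mathcomp Require Import complex.

Set Implicit Arguments.
Unset Strict Implicit.
Unset Printing Implicit Defensive.

Import Order.TTheory GRing.Theory Num.Theory.
Import numFieldNormedType.Exports.

Local Open Scope classical_set_scope.
Local Open Scope ring_scope.
Local Open Scope complex_scope.

(* C*-algebras need not be unital, so the multiplication cannot come from the
   ring structures of ssralg, which all have a unit.  Norms take their values
   in R[i] (in its nonnegative real part), as for any normedModType R[i]. *)
HB.mixin Record isCStarAlgebra (R : realType) V
    & CompleteNormedModule R[i] V := {
  cmul : V -> V -> V ;
  star : V -> V ;
  cmulA : associative cmul ;
  cmulDl : left_distributive cmul +%R ;
  cmulDr : right_distributive cmul +%R ;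
  cmulZl : forall (c : R[i]) (x y : V), cmul (c *: x) y = c *: cmul x y ;
  cmulZr : forall (c : R[i]) (x y : V), cmul x (c *: y) = c *: cmul x y ;
  starK : involutive star ;
  starD : {morph star : x y / x + y} ;
  starZ : forall (c : R[i]) (x : V), star (c *: x) = c^* *: star x ;
  starM : forall x y : V, star (cmul x y) = cmul (star y) (star x) ;
  norm_cmul : forall x y : V, `|cmul x y| <= `|x| * `|y| ;
  norm_star_cmul : forall x : V, `|cmul (star x) x| = `|x| ^+ 2
}.

#[short(type="cstarAlgType")]
HB.structure Definition CStarAlgebra (R : realType) :=
  { V of CompleteNormedModule R[i] V & isCStarAlgebra R V }.

Notation "x ** y" := (cmul x y) (at level 40, left associativity).

Section CStarSubsets.
Variables (R : realType) (A : cstarAlgType R).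
Implicit Types (S D J : set A).

Definition closed_subspace S := submod_closed (mem S) /\ closed S.

Definition cstar_subalgebra S :=
  [/\ closed_subspace S,
      forall x y, S x -> S y -> S (x ** y)
    & forall x, S x -> S (star x)].

(* The cone S^+ of the C*-algebra S; x <= y in S means positive_in S (y - x). *)
Definition positive_in S : set A := [set star x ** x | x in S].

Definition hereditary_subalgebra D S :=
  [/\ cstar_subalgebra D, D `<=` S
    & forall a b, positive_in D a -> positive_in S b ->
        positive_in S (a - b) -> D b].

Definition cstar_ideal J :=
  [/\ closed_subspace J,
      forall x y, J y -> J (x ** y)
    & forall x y, J x -> J (x ** y)].

Definition nonzero_set S := exists2 x, S x & x != 0.

End CStarSubsets.

Section FellBundle.
Variables (R : realType) (G : groupType) (A : cstarAlgType R).
Variable B : G -> set A.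
Implicit Types (a b : G -> A).

Local Notation e := (1%g : G).

Definition fell_bundle :=
  [/\ forall t, closed_subspace (B t),
      forall t, star @` B t = B (t^-1)%g
    & forall t s x y, B t x -> B s y -> B (t * s)%g (x ** y)].

Definition aperiodic :=
  forall t, t != e -> forall y, B t y ->
  forall D, hereditary_subalgebra D (B e) -> nonzero_set D ->
    inf [set complex.Re `|x ** y ** x|
        | x in [set x | positive_in D x /\ `|x| = 1]] = 0.

(* The direct sum of the B t: finitely supported sections t |-> a t, which
   stand for the formal sums of the a t, with pointwise linear structure. *)
Definition direct_sum : set (G -> A) :=
  [set a | (forall t, B t (a t)) /\ finite_set [set t | a t != 0]].

Definition ds_mul a b : G -> A :=
  fun t => \sum_(s \in [set: G]) (a s ** b (s^-1 * t)%g).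

Definition ds_star a : G -> A := fun t => star (a (t^-1)%g).

Definition ds_unit_fiber (x : A) : G -> A := fun t => if t == e then x else 0.

Definition cstar_norm (N : (G -> A) -> R[i]) :=
  [/\ forall a, direct_sum a -> 0 <= N a,
      forall a, direct_sum a -> N a = 0 -> a = 0,
      forall (c : R[i]) a, direct_sum a -> N (c *: a) = `|c| * N a
    & forall a b, direct_sum a -> direct_sum b -> N (a + b) <= N a + N b]
  /\ (forall a b, direct_sum a -> direct_sum b ->
        N (ds_mul a b) <= N a * N b)
  /\ (forall a, direct_sum a -> N (ds_mul (ds_star a) a) = N a ^+ 2).

Definition topological_grading_norm (N : (G -> A) -> R[i]) :=
  cstar_norm N /\ (forall a, direct_sum a -> `|a e| <= N a).

(* N is minimal for the pointwise order on direct_sum. *)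
Definition reduced_norm (N : (G -> A) -> R[i]) :=
  topological_grading_norm N /\
  forall N', topological_grading_norm N' ->
    (forall a, direct_sum a -> N' a <= N a) ->
    forall a, direct_sum a -> N' a = N a.

(* The C*-algebra C, with the *-homomorphism iota defined on direct_sum (the
   values of iota elsewhere are irrelevant), is the completion for N. *)
Definition cstar_completion (N : (G -> A) -> R[i]) (C : cstarAlgType R)
    (iota : (G -> A) -> C) :=
  [/\ forall (c : R[i]) a b, direct_sum a -> direct_sum b ->
        iota (c *: a + b) = c *: iota a + iota b,
      forall a b, direct_sum a -> direct_sum b ->
        iota (ds_mul a b) = iota a ** iota b,
      forall a, direct_sum a -> iota (ds_star a) = star (iota a),
      forall a, direct_sum a -> `|iota a| = N a
    & closure (iota @` direct_sum) = setT].

(* C is C*_r(B), with canonical map iota; it is unique up to isomorphism. *)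
Definition reduced_cross_sectional_algebra (C : cstarAlgType R)
    (iota : (G -> A) -> C) :=
  exists2 N, reduced_norm N & cstar_completion N iota.

Definition unit_fiber_in (C : cstarAlgType R) (iota : (G -> A) -> C) : set C :=
  [set iota (ds_unit_fiber x) | x in B e].

Definition intersection_property (C : cstarAlgType R)
    (iota : (G -> A) -> C) :=
  forall J : set C, cstar_ideal J -> nonzero_set J ->
    nonzero_set (J `&` unit_fiber_in iota).

End FellBundle.

(* Main.v *)
Require Import Defs.
From HB Require Import structures.
From mathcomp Require Import all_boot all_order all_algebra finmap.
From mathcomp Require Import all_classical all_reals all_analysis.
From mathcomp Require Import complex lra ring.

Set Implicit Arguments.
Unset Strict Implicit.
Unset Printing Implicit Defensive.

Import Order.TTheory GRing.Theory Num.Theory.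
Import numFieldNormedType.Exports.

Local Open Scope classical_set_scope.
Local Open Scope ring_scope.
Local Open Scope complex_scope.

(** Let J be an ideal of C = C*_r(B) that meets the image of B_e only in 0, and
let p(a) be the norm of the class of a modulo J, for a in the direct sum of the
fibres.  The proof shows that p is again a C*-norm with |a_e| <= p(a).  Since p
is dominated by the reduced norm N and N is minimal among such norms, p = N:
the quotient map by J is isometric on a dense set, hence J = 0.

Three facts make p such a norm.
- The quotient norm satisfies the C*-identity ([quotient_normC]).  For j in J,
  the elements d = (1 - t j* j)^n are contractions with 1 - d in J and j d
  small ([approx_unit]), so multiplying by d removes j from x* x + j.
- On B_e, p is the original norm.  It is definite there because J meets B_e
  trivially, and a definite C*-norm on a C*-algebra is the given one
  ([cstar_norm_unique]).  By the C*-identity, p = |.| on every other fibre.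
- Aperiodicity gives |a_e| <= p(a) ([expectation_contractive]).  Write E(a) for
  a_e and c for E(a* a), a positive element.  Choose a hereditary subalgebra of
  B_e on which c is bounded below by a fixed multiple of |c| ([corner_of]), and
  shrink it once for each of the finitely many other terms of b = a* a, to
  make all the x b_t x small ([shrink]).  For x of norm 1 in the last
  subalgebra, p(b) >= p(x b x) is at least |x c x| up to a small error, so
  |E(a* a)| <= 16 p(a)^2.  As |E(a)|^2 <= |E(a* a)|, applying the bound to
  iterated squares a, a* a, (a* a)^2, ... and taking roots removes the
  constant 16 ([le_of_squares]).

The estimates on elements need a fragment of continuous functional calculus.
It is developed in the unitization U of a C*-algebra without spectra or Gelfand
theory.  Square roots of 1 - a come from the iteration s := (a + s^2) / 2; if h
is self-adjoint with |h| <= 1 and k = sqrt(1 - h^2), then h + ik is unitary,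
which bounds h and 1 - h^2 and makes positivity of a equivalent to
|M - a| <= M for some M.  Fukamiya's theorem that z* z is positive
([pos_adj_mul]) follows.  The other tool is [bump]: for h >= 0 of norm 1 there
are y with h y <> 0 and m of norm at most 4 that inverts h there, in the sense
that m h (h y) = h y.  Namely, m = 1 / max(h, 1/2) and y = 2 (h - 1/2)_+.  It
provides the corners on which an
element is bounded below, as well as the lower bound for C*-norms.

When an element is constructed as a limit, it belongs to every norm-closed
unital subalgebra containing its ingredients ([closed_subalg]).  Applied to
commutants and to unitizations of subalgebras, this single clause supplies all
the commutation and membership facts that functional calculus would give. *)

(** * Real-valued norms *)

Section RealNorm.
Variable R : realType.

(** Norms over the field R[i] take values in R[i]; order arguments are made in R. *)
Definition rnorm (V : normedZmodType R[i]) (x : V) : R := complex.Re `|x|.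

Lemma rnormE (V : normedZmodType R[i]) (x : V) : `|x| = (rnorm x)%:C.
Proof.
by rewrite [LHS]complexE (ger0_Im (normr_ge0 x)) mulr0 addr0.
Qed.

Section Zmod.
Variable V : normedZmodType R[i].
Implicit Types x y : V.

Lemma rnorm_ge0 x : 0 <= rnorm x.
Proof. by rewrite -ler0c -rnormE normr_ge0. Qed.

Lemma rnorm0 : rnorm (0 : V) = 0.
Proof. by rewrite /rnorm normr0. Qed.

Lemma rnorm_eq0 x : rnorm x = 0 -> x = 0.
Proof. by move=> h; apply/eqP; rewrite -normr_eq0 rnormE h. Qed.

Lemma rnormN x : rnorm (- x) = rnorm x.
Proof. by rewrite /rnorm normrN. Qed.

Lemma rnormB x y : rnorm (x - y) = rnorm (y - x).
Proof. by rewrite -rnormN opprB. Qed.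

Lemma rnormD x y : rnorm (x + y) <= rnorm x + rnorm y.
Proof. by have := ler_normD x y; rewrite !rnormE -rmorphD /= lecR. Qed.

End Zmod.

Lemma rnormM (c d : R[i]) : rnorm (c * d) = rnorm c * rnorm d.
Proof. by apply: complexI; rewrite rmorphM /= -!rnormE normrM. Qed.

Lemma rnormcJ (c : R[i]) : rnorm c^* = rnorm c.
Proof. by rewrite /rnorm normcJ. Qed.

Lemma rnormJM (c : R[i]) : rnorm (c^* * c) = rnorm c ^+ 2.
Proof. by rewrite rnormM rnormcJ. Qed.

Lemma rnorm_real (t : R) : rnorm t%:C = `|t|.
Proof.
by rewrite /rnorm normc_def /= expr0n addr0 sqrtr_sqr.
Qed.

Lemma rnorm1 : rnorm (1 : R[i]) = 1.
Proof. by rewrite /rnorm normr1. Qed.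

Lemma Re_le_rnorm (c : R[i]) : `|complex.Re c| <= rnorm c.
Proof. by rewrite -lecR -rnormE; exact: normc_ge_Re. Qed.

Lemma rnorm_i : rnorm ('i%C : R[i]) = 1.
Proof. by rewrite /rnorm normc_def /= expr0n add0r expr1n sqrtr1. Qed.

Lemma Im_le_rnorm (c : R[i]) : `|complex.Im c| <= rnorm c.
Proof.
have := Re_le_rnorm (c * 'i%C); rewrite ReiNIm normrN rnormM.
by rewrite rnorm_i mulr1.
Qed.

Lemma rnorm_le_ReIm (c : R[i]) : rnorm c <= `|complex.Re c| + `|complex.Im c|.
Proof.
rewrite {1}(complexE c); apply: (le_trans (rnormD _ _)).
rewrite rnormM !rnorm_real.
by rewrite rnorm_i mul1r.
Qed.

Lemma rnormZ (V : normedModType R[i]) (c : R[i]) (x : V) :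
  rnorm (c *: x) = rnorm c * rnorm x.
Proof. by apply: complexI; rewrite rmorphM /= -!rnormE normrZ. Qed.

Definition cauchy_sequence (T : zmodType) (f : T -> R) (u : nat -> T) :=
  forall e, 0 < e -> exists N, forall n m, (N <= n)%N -> (N <= m)%N ->
    f (u n - u m) <= e.

Definition tends_to (T : zmodType) (f : T -> R) (u : nat -> T) (l : T) :=
  forall e, 0 < e -> exists N, forall n, (N <= n)%N -> f (u n - l) <= e.

Lemma complex_gt0 (e : R[i]) : 0 < e -> exists2 r : R, 0 < r & e = r%:C.
Proof.
rewrite ltcE => /andP[/eqP /= h1 h2]; exists (complex.Re e) => //.
by rewrite [LHS]complexE h1 mulr0 addr0.
Qed.

(** Completeness in the epsilon-N form used by the iterations below. *)
Lemma complete_cauchy (V : completeNormedModType R[i]) (u : nat -> V) :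
  cauchy_sequence (@rnorm V) u -> exists l, tends_to (@rnorm V) u l.
Proof.
move=> uc; have : cauchy (u n @[n --> \oo]).
  apply: cauchy_exP => _ /complex_gt0[r r0 ->].
  have r2 : 0 < r / 2 by rewrite divr_gt0.
  have [N hN] := uc _ r2.
  exists (u N); exists N => // n /= Nn.
  rewrite -ball_normE /= rnormE ltcR.
  apply: (le_lt_trans (hN N n _ Nn)) => //.
  lra.
move/cauchy_cvg => /cvg_ex [l ul]; exists l => e e0.
have ec : 0 < e%:C :> R[i] by rewrite ltcR.
move/cvgrPdist_le/(_ _ ec): ul.
move=> [N _ hN]; exists N => n /hN /=.
by rewrite rnormE lecR rnormB.
Qed.

Lemma real_cauchy (u : nat -> R) :
  cauchy_sequence Num.norm u -> exists l, tends_to Num.norm u l.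
Proof.
move=> uc; have : cauchy (u n @[n --> \oo]).
  apply: cauchy_exP => r r0.
  have r2 : 0 < r / 2 by rewrite divr_gt0.
  have [N hN] := uc _ r2.
  exists (u N); exists N => // n /= Nn.
  rewrite -ball_normE /=.
  apply: (le_lt_trans (hN N n _ Nn)) => //.
  lra.
move/cauchy_cvg => /cvg_ex [l ul]; exists l => e e0.
move/cvgrPdist_le/(_ _ e0): ul.
move=> [N _ hN]; exists N => n /hN /=.
by rewrite distrC.
Qed.

Lemma complex_cauchy (u : nat -> R[i]) :
  cauchy_sequence (@rnorm _) u -> exists l, tends_to (@rnorm _) u l.
Proof.
move=> uc.
have [a ha] : exists l, tends_to Num.norm (fun n => complex.Re (u n)) l.
  apply: real_cauchy => e /uc[N hN]; exists N => n m /hN /[apply] h.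
  by apply: le_trans h; rewrite -raddfB; exact: Re_le_rnorm.
have [b hb] : exists l, tends_to Num.norm (fun n => complex.Im (u n)) l.
  apply: real_cauchy => e /uc[N hN]; exists N => n m /hN /[apply] h.
  by apply: le_trans h; rewrite -raddfB; exact: Im_le_rnorm.
exists (a +i* b) => e e0.
have e2 : 0 < e / 2 by rewrite divr_gt0.
have [N hN] := ha _ e2; have [M hM] := hb _ e2.
exists (maxn N M) => n; rewrite geq_max => /andP[/hN h1 /hM h2].
apply: (le_trans (rnorm_le_ReIm _)).
have -> : complex.Re (u n - (a +i* b)) = complex.Re (u n) - a by case: (u n).
have -> : complex.Im (u n - (a +i* b)) = complex.Im (u n) - b by case: (u n).
lra.
Qed.

(** Closed sets enter all later arguments through this pair of lemmas, which
trades filters for real radii. *)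
Lemma closed_adherent (V : normedModType R[i]) (S : set V) : closed S ->
  forall x, (forall e, 0 < e -> exists2 y, S y & rnorm (x - y) <= e) -> S x.
Proof.
move=> Sc x h; apply: Sc => W /nbhs_ballP[_ /= /complex_gt0[r r0 ->]] bW.
have r2 : 0 < r / 2 by rewrite divr_gt0.
have [y Sy yx] := h _ r2; exists y; split=> //; apply: bW.
rewrite -ball_normE /= rnormE ltcR; apply: (le_lt_trans yx); lra.
Qed.

Lemma adherent_closed (V : normedModType R[i]) (S : set V) :
  (forall x, (forall e, 0 < e -> exists2 y, S y & rnorm (x - y) <= e) -> S x) ->
  closed S.
Proof.
move=> h x xS; apply: h => e e0.
have ec : 0 < e%:C :> R[i] by rewrite ltcR.
have [y [Sy]] := xS _ (nbhsx_ballx x _ ec).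
by rewrite -ball_normE /= rnormE ltcR => /ltW; exists y.
Qed.

Lemma closure_adherent (V : normedModType R[i]) (S : set V) x :
  closure S x -> forall e, 0 < e -> exists2 y, S y & rnorm (x - y) <= e.
Proof.
move=> xS e e0; have ec : 0 < e%:C :> R[i] by rewrite ltcR.
have [y [Sy]] := xS _ (nbhsx_ballx x _ ec).
by rewrite -ball_normE /= rnormE ltcR => /ltW; exists y.
Qed.

Lemma le_addgt0 (x y : R) : (forall e, 0 < e -> x <= y + e) -> x <= y.
Proof. by move=> h; apply/ler_addgt0Pr => e /h. Qed.

End RealNorm.

(** * The unitization of a C*-algebra *)

Section CStarBasics.
Variables (R : realType) (A : cstarAlgType R).
Implicit Types x y z : A.

Lemma cmul0l x : 0 ** x = 0.
Proof. by have := cmulZl 0 0 x; rewrite !scale0r. Qed.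

Lemma cmul0r x : x ** 0 = 0.
Proof. by have := cmulZr 0 x 0; rewrite !scale0r. Qed.

Lemma cmulNl x y : (- x) ** y = - (x ** y).
Proof. by have := cmulZl (-1) x y; rewrite !scaleN1r. Qed.

Lemma cmulNr x y : x ** (- y) = - (x ** y).
Proof. by have := cmulZr (-1) x y; rewrite !scaleN1r. Qed.

Lemma starZc (c : R[i]) x : star (c *: x) = conjc c *: star x.
Proof. exact: starZ. Qed.

Lemma star0 : star (0 : A) = 0.
Proof. by have := starZc 0 (0 : A); rewrite conjc0 !scale0r. Qed.

Lemma starN x : star (- x) = - star x.
Proof. by apply/eqP; rewrite -addr_eq0 -starD addNr star0. Qed.

Lemma rnorm_cmul x y : rnorm (x ** y) <= rnorm x * rnorm y.
Proof. by have := norm_cmul x y; rewrite !rnormE -rmorphM /= lecR. Qed.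

Lemma rnorm_star_cmul x : rnorm (star x ** x) = rnorm x ^+ 2.
Proof. by apply: complexI; rewrite rmorphXn /= -!rnormE norm_star_cmul. Qed.

Lemma rnorm_star x : rnorm (star x) = rnorm x.
Proof.
suff le (y : A) : rnorm y <= rnorm (star y).
  by apply/le_anti; rewrite le -{2}(starK x) le.
have [->|y0] := eqVneq (rnorm y) 0; first exact: rnorm_ge0.
have yp : 0 < rnorm y by rewrite lt_def y0 rnorm_ge0.
by rewrite -(ler_pM2r yp) -expr2 -rnorm_star_cmul rnorm_cmul.
Qed.

End CStarBasics.

(** The scalars are listed first.  The module structure is that of the product;
multiplication, adjoint and norm are defined below. *)
Definition unitization (R : realType) (A : cstarAlgType R) : Type :=
  (R[i]^o * A)%type.

Section Unitization.
Variables (R : realType) (A : cstarAlgType R).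
Local Notation U := (unitization A).

HB.instance Definition _ := GRing.Lmodule.copy U (R[i]^o * A)%type.

Definition unitization_one : U := (1, 0).

Definition unitization_mul (z w : U) : U :=
  (z.1 * w.1, z.1 *: w.2 + w.1 *: z.2 + z.2 ** w.2).

(** The left multiplication on A by an element of its unitization. *)
Definition act (z : U) (y : A) : A := z.1 *: y + z.2 ** y.

Lemma unitization_mulA : associative unitization_mul.
Proof.
move=> [a x] [b y] [c z]; rewrite /unitization_mul /=; congr pair.
  by rewrite mulrA.
rewrite !(cmulDl, cmulDr, scalerDr, cmulZl, cmulZr, scalerA, cmulA).
rewrite [c * a]mulrC [c * b]mulrC -!addrA; congr (_ + (_ + _)).
rewrite [LHS]addrCA; congr (_ + _); rewrite [RHS]addrCA; congr (_ + _).
by rewrite [RHS]addrCA.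
Qed.

Lemma unitization_mul1r : left_id unitization_one unitization_mul.
Proof.
by move=> [a x]; rewrite /unitization_mul /= mul1r scale1r scaler0 addr0 cmul0l addr0.
Qed.

Lemma unitization_mulr1 : right_id unitization_one unitization_mul.
Proof.
by move=> [a x]; rewrite /unitization_mul /= mulr1 scale1r scaler0 add0r cmul0r addr0.
Qed.

Lemma unitization_mulDl : left_distributive unitization_mul +%R.
Proof.
move=> [a x] [b y] [c z]; rewrite /unitization_mul /=; congr pair.
  by rewrite /= mulrDl.
by rewrite /= scalerDl scalerDr cmulDl [X in X + _ = _]addrACA [LHS]addrACA.
Qed.

Lemma unitization_mulDr : right_distributive unitization_mul +%R.
Proof.
move=> [a x] [b y] [c z]; rewrite /unitization_mul /=; congr pair.
  by rewrite /= mulrDr.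
by rewrite /= scalerDl scalerDr cmulDr [X in X + _ = _]addrACA [LHS]addrACA.
Qed.

Lemma unitization_one_neq0 : unitization_one != 0.
Proof. by apply/eqP => -[/eqP]; rewrite oner_eq0. Qed.

HB.instance Definition _ := GRing.Zmodule_isNzRing.Build U unitization_mulA
  unitization_mul1r unitization_mulr1 unitization_mulDl unitization_mulDr
  unitization_one_neq0.

Lemma unitization_scalerAl (c : R[i]) (z w : U) : c *: (z * w) = (c *: z) * w.
Proof.
case: z w => [a x] [b y]; congr pair; first by rewrite /= scalerAl.
by rewrite /= !scalerDr !scalerA cmulZl [c * b]mulrC.
Qed.

HB.instance Definition _ :=
  GRing.Lmodule_isLalgebra.Build R[i] U unitization_scalerAl.

Lemma unitization_scalerAr (c : R[i]) (z w : U) : c *: (z * w) = z * (c *: w).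
Proof.
case: z w => [a x] [b y]; congr pair; first by rewrite /= scalerAr.
by rewrite /= !scalerDr !scalerA cmulZr [c * a]mulrC.
Qed.

HB.instance Definition _ :=
  GRing.Lalgebra_isAlgebra.Build R[i] U unitization_scalerAr.

Definition adj (z : U) : U := (z.1^*%C, star z.2).

Definition emb (x : A) : U := (0, x).

Definition uscal (t : R) : U := (t%:C)%:A.

Definition act_bound (z : U) (M : R) :=
  rnorm z.1 <= M /\ forall y, rnorm (act z y) <= M * rnorm y.

(** The norm is the least M with |z.1| <= M and |z y| <= M |y| for all y in A.
The operator norm alone is not definite on the unitization when A already has
a unit; taking the larger of it and |z.1| repairs this, and keeps the
C*-identity because both are C*-seminorms. *)
Definition unorm (z : U) : R := inf [set M | act_bound z M].

Lemma adjK : involutive adj.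
Proof. by move=> [a x]; rewrite /adj /= conjcK starK. Qed.

Lemma adjD z w : adj (z + w) = adj z + adj w.
Proof. by rewrite /adj /= rmorphD starD. Qed.

Lemma adjM z w : adj (z * w) = adj w * adj z.
Proof.
rewrite /adj /= rmorphM mulrC; congr pair.
by rewrite !starD !starZc starM [X in X + _]addrC.
Qed.

Lemma adjZ c z : adj (c *: z) = c^*%C *: adj z.
Proof. by rewrite /adj /= rmorphM starZc. Qed.

Lemma adj1 : adj 1 = 1.
Proof. by congr pair; [exact: conjc1 | exact: star0]. Qed.

Lemma adj0 : adj 0 = 0.
Proof. by congr pair; [exact: conjc0 | exact: star0]. Qed.

Lemma adjN z : adj (- z) = - adj z.
Proof. by rewrite /adj /= rmorphN starN. Qed.

Lemma adj_uscal t : adj (uscal t) = uscal t.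
Proof. by rewrite /uscal adjZ adj1; rewrite conjc_real. Qed.

Lemma actD z w y : act (z + w) y = act z y + act w y.
Proof. by rewrite /act /= scalerDl cmulDl addrACA. Qed.

Lemma actM z w y : act (z * w) y = act z (act w y).
Proof.
rewrite /act /= !(cmulDl, scalerDr, cmulDr) !(cmulZl, cmulZr, scalerA) cmulA.
by rewrite -!addrA; congr (_ + (_ + _)); rewrite mulrC.
Qed.

Lemma actZ c z y : act (c *: z) y = c *: act z y.
Proof. by rewrite /act /= scalerDr scalerA cmulZl. Qed.

Lemma act_emb x y : act (emb x) y = x ** y.
Proof. by rewrite /act /= scale0r add0r. Qed.

Lemma mul_emb z y : z * emb y = emb (act z y).
Proof. by congr pair; rewrite /= ?mulr0 // scale0r addr0. Qed.

(** The action is adjointable: the identity behind the C*-identity below. *)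
Lemma act_adj z x y : star x ** act z y = star (act (adj z) x) ** y.
Proof.
by rewrite /act /= starD starZc starM conjcK starK cmulDl cmulDr cmulZl cmulZr cmulA.
Qed.

Lemma act_bound_ge0 z M : act_bound z M -> 0 <= M.
Proof. by move=> [h _]; apply: le_trans h; apply: rnorm_ge0. Qed.

Lemma act_bound_ex z : act_bound z (rnorm z.1 + rnorm z.2).
Proof.
split; first by rewrite lerDl rnorm_ge0.
move=> y; rewrite mulrDl; apply: (le_trans (rnormD _ _)).
by rewrite rnormZ lerD // rnorm_cmul.
Qed.

Lemma unorm_le z M : act_bound z M -> unorm z <= M.
Proof. by move=> h; apply: ge_inf => //; exists 0 => x /act_bound_ge0. Qed.

(** The infimum is attained, so every norm estimate below can be proved by
exhibiting an operator bound. *)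
Lemma act_bound_unorm z : act_bound z (unorm z).
Proof.
have ne : [set M | act_bound z M] !=set0.
  by exists (rnorm z.1 + rnorm z.2); exact: act_bound_ex.
have adh e : 0 < e -> exists2 M, act_bound z M & M < unorm z + e.
  move=> e0; have [|M hM ltM] := @inf_adherent R [set M | act_bound z M] e e0.
    by split=> //; exists 0 => x /act_bound_ge0.
  by exists M.
split=> [|y]; apply: le_addgt0 => e e0.
  by have [M [h _] ltM] := adh _ e0; apply: (le_trans h); exact: ltW.
have [y0|y0] := eqVneq (rnorm y) 0.
  by rewrite (rnorm_eq0 y0) /act scaler0 cmul0r addr0 rnorm0 mulr0 add0r ltW.
have yp : 0 < rnorm y by rewrite lt_def y0 rnorm_ge0.
have [M [_ h] ltM] := adh _ (divr_gt0 e0 yp); apply: (le_trans (h y)).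
by apply: (le_trans (ler_wpM2r (ltW yp) (ltW ltM))); rewrite mulrDl divfK.
Qed.

Lemma unorm_ge0 z : 0 <= unorm z.
Proof. exact: act_bound_ge0 (act_bound_unorm z). Qed.

Lemma rnorm_act z y : rnorm (act z y) <= unorm z * rnorm y.
Proof. by case: (act_bound_unorm z). Qed.

Lemma unormD z w : unorm (z + w) <= unorm z + unorm w.
Proof.
apply: unorm_le; split.
  by apply: (le_trans (rnormD _ _)); rewrite lerD //; apply: (act_bound_unorm _).1.
move=> y; rewrite actD mulrDl; apply: (le_trans (rnormD _ _)).
by rewrite lerD // rnorm_act.
Qed.

Lemma unormM z w : unorm (z * w) <= unorm z * unorm w.
Proof.
apply: unorm_le; split.
  by rewrite rnormM ler_pM ?rnorm_ge0 //; apply: (act_bound_unorm _).1.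
move=> y; rewrite actM; apply: (le_trans (rnorm_act _ _)).
by rewrite -mulrA ler_wpM2l ?unorm_ge0 ?rnorm_act.
Qed.

Lemma unormZ_le c z : unorm (c *: z) <= rnorm c * unorm z.
Proof.
apply: unorm_le; split=> [|y].
  by rewrite rnormM ler_wpM2l ?rnorm_ge0 //; apply: (act_bound_unorm _).1.
by rewrite actZ rnormZ -mulrA ler_wpM2l ?rnorm_ge0 ?rnorm_act.
Qed.

Lemma unormZ c z : unorm (c *: z) = rnorm c * unorm z.
Proof.
apply/le_anti; rewrite unormZ_le /=.
have [->|c0] := eqVneq c 0; first by rewrite rnorm0 mul0r unorm_ge0.
rewrite -{1}(scalerK c0 z).
apply: (le_trans (ler_wpM2l (rnorm_ge0 _) (unormZ_le _ _))).
by rewrite mulrA -rnormM divff // rnorm1 mul1r.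
Qed.

Lemma unormN z : unorm (- z) = unorm z.
Proof. by rewrite -scaleN1r unormZ rnormN rnorm1 mul1r. Qed.

Lemma unormB z w : unorm (z - w) = unorm (w - z).
Proof. by rewrite -unormN opprB. Qed.

Lemma unorm0 : unorm 0 = 0.
Proof. by rewrite -(scale0r 0) unormZ rnorm0 mul0r. Qed.

(** The action on star x attains the norm of x. *)
Lemma unorm_emb x : unorm (emb x) = rnorm x.
Proof.
apply/le_anti/andP; split.
  by apply: unorm_le; split=> [|y]; rewrite ?rnorm0 ?rnorm_ge0 ?act_emb ?rnorm_cmul.
have [->|x0] := eqVneq (rnorm x) 0; first exact: unorm_ge0.
have xp : 0 < rnorm x by rewrite lt_def x0 rnorm_ge0.
have := rnorm_act (emb x) (star x); rewrite act_emb rnorm_star -{1}(starK x).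
by rewrite rnorm_star_cmul rnorm_star expr2 ler_pM2r.
Qed.

Lemma unorm_eq0 z : unorm z = 0 -> z = 0.
Proof.
move=> h; have z1 : z.1 = 0.
  by apply: rnorm_eq0; apply/le_anti; rewrite rnorm_ge0 -{1}h (act_bound_unorm z).1.
have z2 : z = emb z.2 by case: z z1 {h} => [a x] /= ->.
by move: h; rewrite z2 unorm_emb => /rnorm_eq0 ->.
Qed.

(** As for operators on a Hilbert space, with |y|^2 = |star y ** y| in the
role of the inner product. *)
Lemma unorm_sq_le z : unorm z ^+ 2 <= unorm (adj z * z).
Proof.
set K := unorm (adj z * z); have K0 : 0 <= K := unorm_ge0 _.
suff : unorm z <= Num.sqrt K.
  by move=> h; rewrite -(sqr_sqrtr K0) ler_sqr ?nnegrE ?unorm_ge0 ?sqrtr_ge0.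
have [b1 b2] := act_bound_unorm (adj z * z).
apply: unorm_le; split=> [|y].
  by rewrite -(@ger0_norm _ (rnorm z.1)) ?rnorm_ge0 // -sqrtr_sqr ler_wsqrtr // -rnormJM.
rewrite -[rnorm y](@ger0_norm _ (rnorm y)) ?rnorm_ge0 // -sqrtr_sqr -sqrtrM //.
rewrite -[rnorm (act _ _)]ger0_norm ?rnorm_ge0 // -sqrtr_sqr ler_wsqrtr //.
rewrite -rnorm_star_cmul -{1}(adjK z) -act_adj -actM.
apply: (le_trans (rnorm_cmul _ _)); rewrite rnorm_star mulrC expr2 mulrA.
by rewrite ler_wpM2r ?rnorm_ge0.
Qed.

Lemma unorm_adj z : unorm (adj z) = unorm z.
Proof.
suff le w : unorm w <= unorm (adj w).
  by apply/le_anti; rewrite le -{2}(adjK z) le.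
have [->|y0] := eqVneq (unorm w) 0; first exact: unorm_ge0.
have yp : 0 < unorm w by rewrite lt_def y0 unorm_ge0.
rewrite -(ler_pM2r yp) -expr2; apply: (le_trans (unorm_sq_le w)).
exact: unormM.
Qed.

Lemma unorm_cstar z : unorm (adj z * z) = unorm z ^+ 2.
Proof.
apply/le_anti; rewrite unorm_sq_le andbT; apply: (le_trans (unormM _ _)).
by rewrite unorm_adj expr2.
Qed.

Lemma unorm1 : unorm 1 = 1.
Proof.
have h := unorm_cstar 1; rewrite adj1 mul1r expr2 in h.
have : unorm 1 != 0 by apply/eqP => /unorm_eq0/eqP; rewrite oner_eq0.
by move=> h0; apply: (mulfI h0); rewrite mulr1.
Qed.

Lemma unorm_uscal t : unorm (uscal t) = `|t|.
Proof. by rewrite unormZ unorm1 mulr1 rnorm_real. Qed.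

Lemma rnorm_snd_le (z : U) : rnorm z.2 <= 2 * unorm z.
Proof.
have -> : rnorm z.2 = unorm (emb z.2) by rewrite unorm_emb.
have -> : emb z.2 = z - (z.1 : R[i])%:A.
  case: z => a x; congr pair => /=; last by rewrite scaler0 subr0.
  by rewrite -[a%:A]/(a * 1) mulr1 subrr.
apply: (le_trans (unormD _ _)); rewrite unormN unormZ unorm1 mulr1.
by have := (act_bound_unorm z).1; lra.
Qed.

(** The norm of the unitization is equivalent to the sum of the norms of the
components, which range over complete spaces. *)
Lemma complete_unorm (u : nat -> U) :
  cauchy_sequence unorm u -> exists l, tends_to unorm u l.
Proof.
have le1 (z : U) : rnorm z.1 <= unorm z by case: (act_bound_unorm z).
have le2 (z : U) : rnorm z.2 <= 2 * unorm z := rnorm_snd_le z.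
move=> uc.
have [a ha] : exists l, tends_to (@rnorm _ _) (fun n => (u n).1) l.
  apply: complex_cauchy => e /uc[N hN]; exists N => n m /hN /[apply] h.
  exact: le_trans (le1 (u n - u m)) h.
have [x hx] : exists l, tends_to (@rnorm _ _) (fun n => (u n).2) l.
  apply: complete_cauchy => e e0.
  have e2 : 0 < e / 2 by rewrite divr_gt0.
  have [N hN] := uc _ e2; exists N => n m /hN /[apply] h.
  by apply: (le_trans (le2 (u n - u m))); lra.
exists ((a, x) : U) => e e0.
have e2 : 0 < e / 2 by rewrite divr_gt0.
have [N hN] := ha _ e2; have [M hM] := hx _ e2.
exists (maxn N M) => n; rewrite geq_max => /andP[/hN h1 /hM h2].
apply: (le_trans (unorm_le (act_bound_ex _))) => /=; lra.
Qed.

Lemma emb_mul x z : emb x * z = emb (z.1 *: x + x ** z.2) :> U.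
Proof. by congr pair; rewrite /= ?mul0r // scale0r add0r. Qed.

Lemma adj_emb x : adj (emb x) = emb (star x) :> U.
Proof. by congr pair; exact: conjc0. Qed.

Lemma embM x y : emb x * emb y = emb (x ** y) :> U.
Proof. by rewrite mul_emb act_emb. Qed.

Lemma embD x y : emb (x + y) = emb x + emb y :> U.
Proof. by congr pair; rewrite /= addr0. Qed.

Lemma embZ (c : R[i]) x : emb (c *: x) = c *: emb x :> U.
Proof. by congr pair; rewrite /= scaler0. Qed.

Lemma embN x : emb (- x) = - emb x :> U.
Proof. by congr pair; rewrite /= oppr0. Qed.

Lemma emb_inj : injective emb. Proof. by move=> x y []. Qed.

Lemma emb0 : emb 0 = 0 :> U. Proof. by []. Qed.

End Unitization.

Arguments uscal {R A} t.

(** * Square roots by iteration *)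

Lemma bernoulli (R : realType) (d : R) n : 0 <= d -> 1 + n%:R * d <= (1 + d) ^+ n.
Proof.
move=> d0; elim: n => [|n IH]; first by rewrite mul0r addr0 expr0.
have n0 : 0 <= n%:R :> R by [].
have h : (1 + n%:R * d) * (1 + d) <= (1 + d) ^+ n.+1.
  by rewrite exprSr ler_wpM2r // addr_ge0.
apply: le_trans h; rewrite -natr1.
have : 0 <= n%:R * d * d by rewrite !mulr_ge0.
by nra.
Qed.

(** Taking 2^k-th roots makes a factor that grows linearly in the exponent
harmless. *)
Lemma le_of_pow2_le (R : realType) (x y K : R) : 0 <= x -> 0 <= y ->
  (forall k, x ^+ (2 ^ k) <= K * (2 ^ k).+1%:R * y ^+ (2 ^ k)) -> x <= y.
Proof.
move=> x0 y0 h; rewrite leNgt; apply/negP => yx.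
have xp : 0 < x by apply: le_lt_trans yx.
have [y00|yn] := eqVneq y 0.
  by have := h 0%N; rewrite expn0 !expr1 y00 mulr0 leNgt xp.
have yp : 0 < y by rewrite lt_def yn.
set d := x / y - 1; have dp : 0 < d by rewrite subr_gt0 ltr_pdivlMr // mul1r.
have xE : x = (1 + d) * y by rewrite /d addrC subrK divfK.
have K0 : 0 < K.
  have := h 0%N; rewrite expn0 !expr1 => h0.
  have : 0 < K * 2%:R * y by apply: lt_le_trans h0.
  by rewrite -mulrA pmulr_lgt0 // mulr_gt0.
have key k : (2 ^ k)%:R * d ^+ 2 <= 3 * K.
  have np : 0 < (2 ^ k)%:R :> R by rewrite ltr0n expn_gt0.
  have := h k.+1; rewrite xE exprMn ler_pM2r ?exprn_gt0 // => h1.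
  have h2 := bernoulli (2 ^ k) (ltW dp).
  have h3 : (1 + (2 ^ k)%:R * d) ^+ 2 <= (1 + d) ^+ (2 * 2 ^ k)%N.
    have p1 : 0 <= 1 + (2 ^ k)%:R * d by rewrite addr_ge0 ?mulr_ge0 ?ltW.
    rewrite mulnC exprM lerXn2r ?nnegrE //; exact: le_trans h2.
  rewrite expnS -natr1 natrM in h1.
  have n1 : 1 <= (2 ^ k)%:R :> R by rewrite ler1n expn_gt0.
  rewrite -(ler_pM2l np).
  have h4 := le_trans h3 h1; have nd := mulr_ge0 (ltW np) (ltW dp).
  set n := (2 ^ k)%:R in np n1 nd h4 *.
  have : K <= K * n by rewrite ler_peMr // ltW.
  have : n * (n * d ^+ 2) = (n * d) ^+ 2 by rewrite exprMn expr2 mulrA.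
  by move: h4; set u := n * d in nd *; rewrite sqrrD expr1n => ? -> ?; lra.
have d2 : 0 < d ^+ 2 by rewrite exprn_gt0.
have := key (Num.bound (3 * K / d ^+ 2)).
rewrite -ler_pdivlMr // leNgt => /negP; apply.
have c0 : 0 <= 3 * K / d ^+ 2 by rewrite divr_ge0 ?ltW // mulr_gt0.
have := archi_boundP c0; move/lt_le_trans; apply.
by rewrite ler_nat ltnW // ltn_expl.
Qed.

Section Calculus.
Variables (R : realType) (A : cstarAlgType R).
Local Notation U := (unitization A).
Implicit Types (a b h k s z w : U) (P : set U) (t M : R).

(** A sequence is Cauchy as soon as its steps are bounded by those of a bounded
real sequence, which may be obtained by running the same recursion on reals. *)
Lemma majorized_cauchy (u : nat -> U) (v : nat -> R) t :
  (forall n, unorm (u n.+1 - u n) <= v n.+1 - v n) -> (forall n, v n <= t) ->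
  cauchy_sequence (@unorm _ A) u.
Proof.
move=> uv vt.
have inc n d : unorm (u (n + d)%N - u n) <= v (n + d)%N - v n.
  elim: d => [|d IH]; first by rewrite addn0 !subrr unorm0.
  rewrite addnS; have := uv (n + d)%N.
  have := unormD (u (n + d).+1 - u (n + d)%N) (u (n + d)%N - u n).
  by rewrite addrA subrK; lra.
have hs : has_sup (range v).
  split=> /=; first by exists (v 0%N); exists 0%N.
  by exists t => _ [n _ <-].
move=> e e0; have [_ [N _ <-] hN] := sup_adherent e0 hs.
have vsup n : v n <= sup (range v).
  by apply: (sup_upper_bound hs); exists n.
have mono n d : v n <= v (n + d)%N.
  by rewrite -subr_ge0; apply: le_trans (inc n d); apply: unorm_ge0.
have half n d : (N <= n)%N -> unorm (u (n + d)%N - u n) <= e.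
  move=> Nn; apply: (le_trans (inc n d)).
  have := vsup (n + d)%N; have := mono N (n - N)%N; rewrite subnKC //; lra.
exists N => n m Nn Nm; have [nm|/ltnW mn] := leqP n m.
  by rewrite unormB -(subnKC nm) half.
by rewrite -(subnKC mn) half.
Qed.

(** Closure is stated with real radii.  No stability under adj is asked, so
commutants of single elements qualify. *)
Definition closed_subalg P :=
  [/\ forall c : R[i], P c%:A, forall z w, P z -> P w -> P (z + w),
      forall z w, P z -> P w -> P (z * w)
    & forall z, (forall e, 0 < e -> exists2 w, P w & unorm (z - w) <= e) -> P z].

Lemma closed_subalgZ P (c : R[i]) z : closed_subalg P -> P z -> P (c *: z).
Proof. by move=> [h1 _ h3 _] Pz; rewrite -mulr_algl; exact: h3. Qed.

Lemma closed_subalgB P z w : closed_subalg P -> P z -> P w -> P (z - w).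
Proof.
move=> hP Pz Pw; have [_ h2 _ _] := hP.
by apply: h2 => //; rewrite -scaleN1r; exact: closed_subalgZ.
Qed.

Lemma closed_subalg1 P : closed_subalg P -> P 1.
Proof. by move=> [h _ _ _]; have := h 1; rewrite scale1r. Qed.

Lemma closed_subalg0 P : closed_subalg P -> P 0.
Proof. by move=> [h _ _ _]; have := h 0; rewrite scale0r. Qed.

(** Identities between limits are proved by showing that the difference is
smaller than any multiple of epsilon. *)
Lemma unorm_small z M : (forall e, 0 < e -> unorm z <= M * e) -> z = 0.
Proof.
move=> h; apply: unorm_eq0; apply/le_anti; rewrite unorm_ge0 andbT.
apply: le_addgt0 => e e0; rewrite add0r.
have M0 : 0 < `|M| + 1 by rewrite ltr_wpDl.
apply: (le_trans (h _ (divr_gt0 e0 M0))).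
rewrite mulrA ler_pdivrMr // mulrC ler_pM2l //.
by have := ler_norm M; lra.
Qed.

Lemma closed_subalg_comm x : closed_subalg [set z | z * x = x * z].
Proof.
split=> [c|z w /= hz hw|z w /= hz hw|z h /=].
- by rewrite /= mulr_algl mulr_algr.
- by rewrite mulrDl mulrDr hz hw.
- by rewrite -mulrA hw !mulrA hz.
apply/eqP; rewrite -subr_eq0; apply/eqP.
apply: (@unorm_small _ (2 * unorm x)) => e /h[w /= hw zw].
have -> : z * x - x * z = (z - w) * x - x * (z - w).
  by rewrite mulrBl mulrBr hw opprB addrA subrK.
apply: (le_trans (unormD _ _)); rewrite unormN.
have := unormM (z - w) x; have := unormM x (z - w).
have := ler_wpM2l (unorm_ge0 x) zw; lra.
Qed.

Lemma unormZr t z : unorm (t%:C *: z) = `|t| * unorm z.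
Proof. by rewrite unormZ rnorm_real. Qed.

Lemma adjZr t z : adj (t%:C *: z) = t%:C *: adj z.
Proof. by rewrite adjZ conjc_real. Qed.

Lemma tends_to_adherent (u : nat -> U) l P :
  tends_to (@unorm _ A) u l -> (forall n, P (u n)) ->
  forall e, 0 < e -> exists2 w, P w & unorm (l - w) <= e.
Proof.
by move=> ul Pu e /ul[N hN]; exists (u N) => //; rewrite unormB hN.
Qed.

Lemma tends_to_adj (u : nat -> U) l : tends_to (@unorm _ A) u l ->
  (forall n, adj (u n) = u n) -> adj l = l.
Proof.
move=> ul ua; apply/eqP; rewrite -subr_eq0; apply/eqP.
apply: (@unorm_small _ 2) => e /ul[N /(_ _ (leqnn N)) h].
have -> : adj l - l = adj (l - u N) + (u N - l).
  by rewrite adjD adjN ua addrA subrK.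
apply: (le_trans (unormD _ _)); rewrite unorm_adj (unormB l); lra.
Qed.

Lemma tends_to_le (u : nat -> U) l t : tends_to (@unorm _ A) u l ->
  (forall n, unorm (u n) <= t) -> unorm l <= t.
Proof.
move=> ul ut; apply: le_addgt0 => e /ul[N /(_ _ (leqnn N)) h].
rewrite -(subKr (u N) l); apply: (le_trans (unormD _ _)).
by rewrite unormN lerD.
Qed.

(** The fixed points s satisfy 2 s = a + s^2, that is (1 - s)^2 = 1 - a. *)
Fixpoint sqrt_iter a n : U :=
  if n is m.+1 then (2^-1)%:C *: (a + sqrt_iter a m * sqrt_iter a m) else 0.

(** The same recursion with a = 1; it increases to 1. *)
Fixpoint sqrt_majorant n : R :=
  if n is m.+1 then (1 + sqrt_majorant m ^+ 2) / 2 else 0.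

Lemma sqrt_majorant_bound n : 0 <= sqrt_majorant n <= 1.
Proof.
by elim: n => [|n /andP[h1 h2]] /=; [rewrite lexx ler01 | apply/andP; split; nra].
Qed.

Lemma sqrt_iter_le a n : unorm a <= 1 -> unorm (sqrt_iter a n) <= sqrt_majorant n.
Proof.
move=> a1; elim: n => [|n IH] /=; first by rewrite unorm0.
rewrite unormZr ger0_norm ?invr_ge0 // mulrC ler_wpM2r ?invr_ge0 //.
apply: (le_trans (unormD _ _)); rewrite lerD //.
apply: (le_trans (unormM _ _)); rewrite -expr2.
by rewrite lerXn2r ?nnegrE ?unorm_ge0 //; case/andP: (sqrt_majorant_bound n).
Qed.

Lemma sqrt_iter_in a P n : closed_subalg P -> P a -> P (sqrt_iter a n).
Proof.
move=> hP Pa; elim: n => [|n IH] /=; first exact: closed_subalg0.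
by apply: closed_subalgZ => //; case: hP => _ hD hM _; apply: hD => //; apply: hM.
Qed.

Lemma sqrt_iter_comm a n m :
  sqrt_iter a n * sqrt_iter a m = sqrt_iter a m * sqrt_iter a n.
Proof.
apply: (sqrt_iter_in n (closed_subalg_comm (sqrt_iter a m))).
by apply/esym; apply: (sqrt_iter_in m (closed_subalg_comm a)).
Qed.

(** The difference of consecutive terms factors as half of (x - y)(x + y), both
here and for the majorant. *)
Lemma sqrt_iter_step a n : unorm a <= 1 ->
  unorm (sqrt_iter a n.+1 - sqrt_iter a n)
    <= sqrt_majorant n.+1 - sqrt_majorant n.
Proof.
move=> a1; elim: n => [|n IH].
  rewrite /= mulr0 addr0 subr0 subr0 unormZr ger0_norm ?invr_ge0 // expr0n addr0.
  by rewrite mulrC ler_pM2r ?invr_gt0.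
set x := sqrt_iter a n.+1 in IH *; set y := sqrt_iter a n in IH *.
have -> : sqrt_iter a n.+2 - x = (2^-1)%:C *: ((x - y) * (x + y)).
  rewrite {2}/x /= -scalerBr; congr (_ *: _).
  rewrite opprD addrACA subrr add0r -/x -/y mulrBl !mulrDr.
  by rewrite [y * x]sqrt_iter_comm opprD addrA addrK.
rewrite unormZr ger0_norm ?invr_ge0 //.
have hx := sqrt_iter_le n.+1 a1; have hy := sqrt_iter_le n a1.
have hM := unormM (x - y) (x + y); have hD := unormD x y.
have hxy : unorm (x + y) <= sqrt_majorant n.+1 + sqrt_majorant n.
  by apply: (le_trans hD); rewrite lerD.
have := ler_pM (unorm_ge0 (x - y)) (unorm_ge0 (x + y)) IH hxy.
rewrite [sqrt_majorant n.+2]/=.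
have -> : sqrt_majorant n.+1 = (1 + sqrt_majorant n ^+ 2) / 2 by [].
set p := sqrt_majorant n; nra.
Qed.

(** The root is a norm limit of polynomials in a, so it lies in every closed
subalgebra containing a. *)
Lemma sqrt_one_sub a : adj a = a -> unorm a <= 1 -> exists k,
  [/\ k * k = 1 - a, adj k = k, unorm (1 - k) <= 1
    & forall P, closed_subalg P -> P a -> P k].
Proof.
move=> aa a1; have bd n : unorm (sqrt_iter a n) <= 1.
  apply: (le_trans (sqrt_iter_le n a1)).
  by case/andP: (sqrt_majorant_bound n).
have /complete_unorm[s us] : cauchy_sequence (@unorm _ A) (sqrt_iter a).
  apply: (majorized_cauchy (v := sqrt_majorant) (t := 1)).
    by move=> n; exact: sqrt_iter_step.
  by move=> n; case/andP: (sqrt_majorant_bound n).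
have sP P : closed_subalg P -> P a -> P s.
  move=> hP Pa; have [_ _ _ hC] := hP; apply: hC.
  by apply: (tends_to_adherent us) => n; exact: sqrt_iter_in.
have s1 : unorm s <= 1 := tends_to_le us bd.
have sa : adj s = s.
  apply: (tends_to_adj us); elim=> [|n IH] /=; first exact: adj0.
  by rewrite adjZr adjD adjM aa IH.
have sE : s + s = a + s * s.
  apply/eqP; rewrite -subr_eq0; apply/eqP.
  apply: (@unorm_small _ 4) => e /us[N hN].
  set x := sqrt_iter a N; set y := sqrt_iter a N.+1.
  have hx : unorm (x - s) <= e by exact: hN.
  have hy : unorm (y - s) <= e by exact: hN.
  have yE : y + y = a + x * x.
    rewrite /y /= -scalerDl -rmorphD /=.
    by rewrite (_ : 2^-1 + 2^-1 = 1) ?scale1r //; lra.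
  have -> : s + s - (a + s * s) =
      (s - y) + (s - y) + ((x - s) * x + s * (x - s)).
    have -> : (x - s) * x + s * (x - s) = x * x - s * s.
      by rewrite mulrBl mulrBr addrA subrK.
    have -> : (s - y) + (s - y) = s + s - (a + x * x).
      by rewrite addrACA -opprD yE.
    by rewrite !opprD !addrA subrK.
  have := unormD ((s - y) + (s - y)) ((x - s) * x + s * (x - s)).
  have := unormD (s - y) (s - y); have := unormD ((x - s) * x) (s * (x - s)).
  have := unormM (x - s) x; have := unormM s (x - s).
  have := bd N; rewrite -/x (unormB s) => hb.
  have := ler_pM (unorm_ge0 _) (unorm_ge0 _) hx hb.
  have := ler_pM (unorm_ge0 _) (unorm_ge0 _) s1 hx.
  lra.
exists (1 - s); split.
- have -> : (1 - s) * (1 - s) = 1 - (s + s) + s * s.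
    by rewrite mulrBl mul1r mulrBr mulr1 opprB addrA addrAC opprD !addrA.
  by rewrite sE opprD addrA subrK.
- by rewrite adjD adjN adj1 sa.
- by rewrite subKr.
move=> P hP Pa; apply: closed_subalgB => //; [exact: closed_subalg1 | exact: sP].
Qed.

End Calculus.

(** * Positive elements *)

Section Positive.
Variables (R : realType) (A : cstarAlgType R).
Local Notation U := (unitization A).
Implicit Types (a b c h k s z w : U) (P : set U) (t M : R).

Lemma unorm_sa a : adj a = a -> unorm (a * a) = unorm a ^+ 2.
Proof. by move=> {1}<-; rewrite unorm_cstar. Qed.

(** For h^2 + k^2 = 1 this makes h + ik unitary. *)
Lemma adj_mul_add_i h k : adj h = h -> adj k = k -> h * k = k * h ->
  adj (h + 'i%C *: k) * (h + 'i%C *: k) = h * h + k * k.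
Proof.
move=> ha ka hk; have -> : adj (h + 'i%C *: k) = h - 'i%C *: k.
  rewrite adjD adjZ ha ka; congr (_ + _); rewrite -scaleNr; congr (_ *: _).
  by apply/eqP; rewrite eq_complex /= oppr0 !eqxx.
rewrite mulrBl !mulrDr -!scalerAl -!scalerAr scalerA hk.
have -> : 'i%C * 'i%C = -1 :> R[i] by rewrite -expr2 sqr_i.
by rewrite scaleN1r opprD opprK addrA addrK.
Qed.

Lemma addrr_scale z : z + z = 2%:C *: z.
Proof. by rewrite rmorphD /= scalerDl !scale1r. Qed.

(** The norm of h + ik and of its adjoint is the root of |h^2 + k^2|, and 2 h is
the sum of the two. *)
Lemma unorm_sq_le_sum h k : adj h = h -> adj k = k -> h * k = k * h ->
  unorm h ^+ 2 <= unorm (h * h + k * k).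
Proof.
move=> ha ka hk; set u := h + 'i%C *: k.
have -> : unorm (h * h + k * k) = unorm u ^+ 2.
  by rewrite -unorm_cstar adj_mul_add_i.
rewrite lerXn2r ?nnegrE ?unorm_ge0 //.
have : h + h = u + adj u.
  rewrite adjD adjZ ha ka addrACA -scalerDl.
  have -> : 'i%C + 'i%C^*%C = 0 :> R[i].
    by apply/eqP; rewrite eq_complex /= addr0 subrr !eqxx.
  by rewrite scale0r addr0.
move/(congr1 (@unorm _ A)); have := unormD u (adj u); rewrite unorm_adj.
by rewrite addrr_scale unormZr ger0_norm //; lra.
Qed.

(** With k the square root of 1 - h^2, the previous lemma bounds k by
|h^2 + k^2| = 1. *)
Lemma unorm_one_sub_sq h : adj h = h -> unorm h <= 1 -> unorm (1 - h * h) <= 1.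
Proof.
move=> ha h1.
have hh : adj (h * h) = h * h by rewrite adjM ha.
have hh1 : unorm (h * h) <= 1 by rewrite unorm_sa // expr_le1 ?unorm_ge0.
have [k [kk ka _ kP]] := sqrt_one_sub hh hh1.
have kh : k * h = h * k.
  by apply: (kP _ (closed_subalg_comm h)); rewrite /= mulrA.
rewrite -kk unorm_sa //; apply: (le_trans (unorm_sq_le_sum ka ha kh)).
by rewrite kk subrK unorm1.
Qed.

(** Positivity as being the square of a self-adjoint element; the equivalence with
star z z is Fukamiya's theorem below. *)
Definition pos a := exists2 h, adj h = h & a = h * h.

Lemma pos_sa a : pos a -> adj a = a.
Proof. by move=> [h ha ->]; rewrite adjM ha. Qed.

Lemma pos_sq h : adj h = h -> pos (h * h).
Proof. by exists h. Qed.

Lemma pos0 : pos 0.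
Proof. by exists 0; rewrite ?adj0 ?mulr0. Qed.

Lemma uscalE t : uscal t = t%:C *: (1 : U). Proof. by []. Qed.

Lemma uscal0 : uscal 0 = 0 :> U. Proof. by rewrite uscalE scale0r. Qed.

Lemma uscal1 : uscal 1 = 1 :> U. Proof. by rewrite uscalE scale1r. Qed.

Lemma uscalD t M : uscal (t + M) = uscal t + uscal M :> U.
Proof. by rewrite uscalE rmorphD scalerDl. Qed.

Lemma scale_uscal t M : t%:C *: uscal M = uscal (t * M) :> U.
Proof. by rewrite !uscalE scalerA rmorphM. Qed.

Lemma pos_scale t a : 0 <= t -> pos a -> pos (t%:C *: a).
Proof.
move=> t0 [h ha ->]; exists ((Num.sqrt t)%:C *: h); first by rewrite adjZr ha.
by rewrite -scalerAl -scalerAr scalerA -rmorphM -(expr2 (Num.sqrt t)) sqr_sqrtr.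
Qed.

Lemma pos_uscal t : 0 <= t -> pos (uscal t).
Proof. by move=> t0; apply: pos_scale => //; exists 1; rewrite ?adj1 ?mulr1. Qed.

(** Together with the next lemma this characterizes positive elements by their
distance to scalars, which makes sums of positive elements easy. *)
Lemma pos_uscal_sub_le a M : pos a -> unorm a <= M -> unorm (uscal M - a) <= M.
Proof.
move=> [h ha ->]; rewrite unorm_sa // => hM.
have M0 : 0 <= M by apply: le_trans hM; rewrite exprn_ge0 ?unorm_ge0.
have [M00|Mn] := eqVneq M 0.
  rewrite M00 uscal0 sub0r unormN unorm_sa //; rewrite M00 in hM; exact: hM.
have Mp : 0 < M by rewrite lt_def Mn.
set q := Num.sqrt M; have qp : 0 < q by rewrite sqrtr_gt0.
have qq : q * q = M by rewrite -expr2 sqr_sqrtr.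
have -> : uscal M - h * h = M%:C *: (1 - ((q^-1)%:C *: h) * ((q^-1)%:C *: h)).
  rewrite -scalerAl -scalerAr scalerA scalerBr scalerA -rmorphM -rmorphM /=.
  by rewrite -invfM qq divff // scale1r.
rewrite unormZr ger0_norm // ler_piMr //; apply: unorm_one_sub_sq.
  by rewrite adjZr ha.
rewrite unormZr ger0_norm ?invr_ge0 ?(ltW qp) // mulrC ler_pdivrMr // mul1r.
rewrite -(@ler_sqr _ (unorm h)) ?nnegrE ?unorm_ge0 ?(ltW qp) //.
by rewrite /q sqr_sqrtr.
Qed.

(** After division by M, this is the square root of 1 - (1 - a / M).  The distance
from the root to a scalar shows that the root is positive too. *)
Lemma pos_of_uscal_sub_le a M : adj a = a -> unorm (uscal M - a) <= M -> exists h,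
  [/\ h * h = a, adj h = h, unorm (uscal (Num.sqrt M) - h) <= Num.sqrt M
    & forall P, closed_subalg P -> P a -> P h].
Proof.
move=> aa hM; have M0 : 0 <= M := le_trans (unorm_ge0 _) hM.
have [M00|Mn] := eqVneq M 0.
  have a0 : a = 0.
    apply/eqP; rewrite -oppr_eq0; apply/eqP/unorm_eq0/le_anti.
    by rewrite unorm_ge0 andbT; move: hM; rewrite M00 uscal0 sub0r.
  exists 0; rewrite a0 mulr0 adj0 M00 sqrtr0 uscal0 subrr unorm0; split=> //.
have Mp : 0 < M by rewrite lt_def Mn.
set q := Num.sqrt M; have qp : 0 < q by rewrite sqrtr_gt0.
have qq : q * q = M by rewrite -expr2 sqr_sqrtr.
set b := 1 - (M^-1)%:C *: a.
have bE : b = (M^-1)%:C *: (uscal M - a).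
  by rewrite /b scalerBr scale_uscal mulVf // uscal1.
have ba : adj b = b by rewrite /b adjD adjN adjZr aa adj1.
have b1 : unorm b <= 1.
  by rewrite bE unormZr ger0_norm ?invr_ge0 // mulrC ler_pdivrMr // mul1r.
have [k [kk ka k1 kP]] := sqrt_one_sub ba b1.
exists (q%:C *: k); split.
- rewrite -scalerAl -scalerAr scalerA kk /b subKr scalerA -rmorphM -rmorphM /=.
  by rewrite qq divff // scale1r.
- by rewrite adjZr ka.
- by rewrite uscalE -scalerBr unormZr ger0_norm ?(ltW qp) // ler_piMr // ltW.
move=> P hP Pa; apply: closed_subalgZ => //; apply: kP => //.
apply: closed_subalgB => //; first exact: closed_subalg1.
exact: closed_subalgZ.
Qed.

Lemma posP a M : adj a = a -> unorm (uscal M - a) <= M -> pos a.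
Proof. by move=> aa /(pos_of_uscal_sub_le aa)[h [<- ha _ _]]; exists h. Qed.

Lemma pos_sqrt a : pos a -> exists h,
  [/\ h * h = a, pos h & forall P, closed_subalg P -> P a -> P h].
Proof.
move=> pa; have := pos_uscal_sub_le pa (lexx _).
move=> /(pos_of_uscal_sub_le (pos_sa pa))[h [hh ha hM hP]].
by exists h; split=> //; exact: posP hM.
Qed.

Lemma posD a b : pos a -> pos b -> pos (a + b).
Proof.
move=> pa pb; apply: (@posP _ (unorm a + unorm b)).
  by rewrite adjD !pos_sa.
have := pos_uscal_sub_le pa (lexx _); have := pos_uscal_sub_le pb (lexx _).
rewrite uscalD opprD addrACA; have := unormD (uscal (unorm a) - a) (uscal (unorm b) - b).
lra.
Qed.

Lemma pos_uscal_sub a M : pos a -> unorm a <= M -> pos (uscal M - a).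
Proof.
move=> pa hM; apply: (@posP _ M); last by rewrite subKr.
by rewrite adjD adjN adj_uscal (pos_sa pa).
Qed.

(** The roots of a and b commute, since each lies in the relevant commutant; the
product of the roots is a root of a b. *)
Lemma posM a b : pos a -> pos b -> a * b = b * a -> pos (a * b).
Proof.
move=> /pos_sqrt[h [<- /pos_sa ha hP]] /pos_sqrt[k [<- /pos_sa ka kP]] hk.
have {}hk : h * (k * k) = (k * k) * h by apply: (hP _ (closed_subalg_comm _)).
have {}hk : k * h = h * k by apply: (kP _ (closed_subalg_comm _)) => /=.
exists (h * k); first by rewrite adjM ha ka.
by rewrite -!mulrA; congr (_ * _); rewrite mulrA -{1}hk -mulrA.
Qed.

(** If a = h^2 and M - a = k^2 with commuting h and k, then |h|^2 is at most
|h^2 + k^2| = M. *)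
Lemma pos_unorm_le a M : 0 <= M -> pos a -> pos (uscal M - a) -> unorm a <= M.
Proof.
move=> M0 [h ha ->] /pos_sqrt[k [kk /pos_sa ka kP]].
have hk : k * h = h * k.
  apply: (kP _ (closed_subalg_comm h)) => /=.
  by rewrite mulrBl mulrBr mulrA uscalE -scalerAl -scalerAr mul1r mulr1.
rewrite unorm_sa //; apply: (le_trans (unorm_sq_le_sum ha ka (esym hk))).
by rewrite kk addrC subrK unorm_uscal ger0_norm.
Qed.

Lemma unorm_le_addl a b : pos a -> pos b -> unorm a <= unorm (a + b).
Proof.
move=> pa pb; apply: pos_unorm_le => //; first exact: unorm_ge0.
have := posD (pos_uscal_sub (posD pa pb) (lexx _)) pb.
by rewrite opprD addrA subrK.
Qed.

Lemma pos_anti a : pos a -> pos (- a) -> a = 0.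
Proof.
move=> pa pna; apply: unorm_eq0; apply/le_anti; rewrite unorm_ge0 andbT.
by have := unorm_le_addl pa pna; rewrite subrr unorm0.
Qed.

(** If h^3 = 0 then h^4 = 0, whose norm is that of h to the fourth power. *)
Lemma cube_eq0 h : adj h = h -> h * h * h = 0 -> h = 0.
Proof.
move=> ha h3; have : unorm (h * h * (h * h)) = 0.
  by rewrite mulrA h3 mul0r unorm0.
have hha : adj (h * h) = h * h by rewrite adjM ha.
rewrite (unorm_sa hha) (unorm_sa ha) => /eqP.
by rewrite !expf_eq0 /= => /eqP /unorm_eq0.
Qed.

(** The absolute value of z. *)
Lemma abs_ex z : adj z = z -> exists w,
  [/\ w * w = z * z, pos w & forall P, closed_subalg P -> P z -> P w].
Proof.
move=> za; have [w [ww pw wP]] := pos_sqrt (pos_sq za).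
by exists w; split=> // P hP Pz; apply: wP => //; case: hP => _ _ hM _; exact: hM.
Qed.

(** If - z* z is positive, v = M + z* z has norm at most M = |z* z|.  The element
w = M + z z* satisfies w^n z = z v^n, so |w^n| grows at most like n M^n; as w is
self-adjoint, |w|^(2^k) = |w^(2^k)|, hence |w| <= M.  This replaces the fact
that z z* and z* z have the same nonzero spectrum. *)
Lemma neg_adj_mul_swap z : pos (- (adj z * z)) -> pos (- (z * adj z)).
Proof.
set c := - (adj z * z); set M := unorm c => pc.
have sb : adj (- (z * adj z)) = - (z * adj z) by rewrite adjN adjM adjK.
apply: (@posP _ M) => //; rewrite opprK.
set w := uscal M + z * adj z.
have wa : adj w = w by rewrite /w adjD adj_uscal adjM adjK.
set v := uscal M - c; have vM : unorm v <= M := pos_uscal_sub_le pc (lexx _).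
have M0 : 0 <= M := unorm_ge0 _.
have inter n : w ^+ n * z = z * v ^+ n.
  elim: n => [|n IH]; first by rewrite !expr0 mul1r mulr1.
  rewrite exprSr -mulrA; have -> : w * z = z * v.
    by rewrite /w /v /c opprK mulrDl mulrDr uscalE -scalerAl -scalerAr mul1r mulr1 mulrA.
  by rewrite mulrA IH -mulrA -exprSr.
set K := unorm z ^+ 2; have K0 : 0 <= K by rewrite exprn_ge0 ?unorm_ge0.
have vn n : unorm (v ^+ n) <= M ^+ n.
  elim: n => [|n IH]; first by rewrite !expr0 unorm1.
  rewrite !exprS; apply: (le_trans (unormM _ _)).
  by rewrite ler_pM ?unorm_ge0.
have step n : unorm (w ^+ n.+1) <= M * unorm (w ^+ n) + K * M ^+ n.
  rewrite exprSr {2}/w mulrDr mulrA inter.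
  apply: (le_trans (unormD _ _)); rewrite uscalE -scalerAr mulr1 unormZr ger0_norm // lerD2l.
  apply: (le_trans (unormM _ _)); rewrite unorm_adj /K expr2 mulrAC ler_wpM2r ?unorm_ge0 //.
  by apply: (le_trans (unormM _ _)); rewrite ler_wpM2l ?unorm_ge0.
have [M00|Mn] := eqVneq M 0.
  have : unorm (w * w) <= 0.
    by have := step 1%N; rewrite M00 expr2 !expr1 mul0r mulr0 addr0.
  rewrite unorm_sa // => h; rewrite M00.
  have : unorm w ^+ 2 == 0 by rewrite eq_le h exprn_ge0 ?unorm_ge0.
  by rewrite expf_eq0 /= => /eqP ->.
have Mp : 0 < M by rewrite lt_def Mn.
have bd n : unorm (w ^+ n) <= (1 + n%:R * (K / M)) * M ^+ n.
  elim: n => [|n IH]; first by rewrite !expr0 unorm1 mul0r addr0 mulr1.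
  apply: (le_trans (step n)); rewrite -natr1 exprS.
  have -> : K * M ^+ n = (K / M) * (M * M ^+ n) by rewrite mulrA divfK.
  by have := ler_wpM2l M0 IH; lra.
have wk (k : nat) : unorm (w ^+ (2 ^ k)) = unorm w ^+ (2 ^ k).
  elim: k => [|k IH]; first by rewrite expn0 !expr1.
  rewrite expnS mulnC !exprM -IH expr2 unorm_sa //.
  elim: (2 ^ k)%N => [|n IHn]; first by rewrite !expr0 adj1.
  by rewrite {1}exprS adjM IHn wa -exprSr.
apply: (@le_of_pow2_le _ _ _ (1 + K / M)) => // [|k]; first exact: unorm_ge0.
rewrite -wk; apply: (le_trans (bd _)); rewrite ler_wpM2r ?exprn_ge0 //.
have KM : 0 <= K / M by rewrite divr_ge0.
rewrite -natr1 mulrDl mul1r mulrDr mulr1.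
have : 0 <= (2 ^ k)%:R :> R by []. 
by move: (_ %:R) => n; lra.
Qed.

Lemma adj_decomposition z : exists x y, [/\ adj x = x, adj y = y & z = x + 'i%C *: y].
Proof.
exists ((2^-1)%:C *: (z + adj z)), ((2^-1)%:C *: ('i%C *: (adj z - z))).
split.
- by rewrite adjZr adjD adjK [in LHS]addrC.
- rewrite adjZr adjZ adjD adjN adjK; congr (_ *: _).
  rewrite -(opprB (adj z)) scalerN -scaleNr; congr (_ *: _).
  by apply/eqP; rewrite eq_complex /= oppr0 opprK !eqxx.
have -> w : 'i%C *: ((2^-1)%:C *: ('i%C *: w)) = (2^-1)%:C *: ((-1) *: w) :> U.
  by rewrite !scalerA mulrAC -expr2 sqr_i mulrC.
rewrite -scalerDr scaleN1r opprB addrACA subrr addr0 addrr_scale.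
by rewrite scalerA -rmorphM /= mulVf // scale1r.
Qed.

(** Writing z = x + iy, z* z + z z* = 2 (x^2 + y^2) is positive, and so is - z z*
by the previous lemma; hence z* z is both positive and negative. *)
Lemma adj_mul_eq0_of_neg z : pos (- (adj z * z)) -> z = 0.
Proof.
move=> pn; have pn' := neg_adj_mul_swap pn.
have [x [y [xa ya zE]]] := adj_decomposition z.
have sum : adj z * z + z * adj z = 2%:C *: (x * x + y * y).
  have -> : adj z = x - 'i%C *: y.
    rewrite zE adjD adjZ xa ya; congr (_ + _); rewrite -scaleNr; congr (_ *: _).
    by apply/eqP; rewrite eq_complex /= oppr0 !eqxx.
  rewrite zE; set v := 'i%C *: y.
  have -> : (x - v) * (x + v) + (x + v) * (x - v) = (x * x - v * v) + (x * x - v * v).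
    have e w : (x - w) * (x + w) = (x * x - w * w) + (x * w - w * x).
      by rewrite mulrBl !mulrDr opprD [- _ - _]addrC addrACA.
    rewrite e; have := e (- v); rewrite opprK => ->.
    rewrite mulrN !mulNr mulrN opprK addrACA.
    by rewrite -opprD subrr addr0.
  have vv : v * v = - (y * y).
    rewrite /v -scalerAl -scalerAr scalerA.
    have -> : 'i%C * 'i%C = -1 :> R[i] by rewrite -expr2 sqr_i.
    by rewrite scaleN1r.
  by rewrite vv opprK addrr_scale.
have pz : pos (adj z * z).
  rewrite -(addrK (z * adj z) (adj z * z)) sum; apply: posD => //.
  by apply: pos_scale => //; apply: posD; exact: pos_sq.
apply: unorm_eq0; apply/eqP; have := unorm_cstar z.
rewrite (pos_anti pz pn) unorm0 => /esym/eqP.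
by rewrite expf_eq0.
Qed.

(** Fukamiya's theorem.  Let h = z* z and let n = |h| - h, twice its negative
part.  Then (z n)* (z n) = n h n = - |h| n^2 is negative, so
z n = 0 by the previous lemma, which forces n = 0 and h = |h|. *)
Lemma pos_adj_mul z : pos (adj z * z).
Proof.
set h := adj z * z; have ha : adj h = h by rewrite /h adjM adjK.
have [w [ww pw wP]] := abs_ex ha; have wa := pos_sa pw.
have wh : w * h = h * w by apply: (wP _ (closed_subalg_comm h)).
set n := w - h; have na : adj n = n by rewrite /n adjD adjN wa ha.
have nw : n * w = w * n by rewrite /n mulrBl mulrBr wh.
have nh : n * h = - (n * w).
  by rewrite /n !mulrBl ww wh opprB.
have hn : h * n = n * h by rewrite /n mulrBl mulrBr wh.
have e : - (adj (z * n) * (z * n)) = w * (n * n).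
  rewrite adjM na -mulrA [adj z * _]mulrA -/h hn nh.
  by rewrite mulrN opprK nw !mulrA nw.
have zn : z * n = 0.
  apply: adj_mul_eq0_of_neg; rewrite e; apply: posM => //; first exact: pos_sq.
  by rewrite mulrA -nw -mulrA -nw mulrA.
have n3 : n * n * n = 0.
  have wnn : w * (n * n) = 0 by rewrite -e zn mulr0 oppr0.
  have hnn : h * (n * n) = 0 by rewrite mulrA /h -(mulrA _ z n) zn mulr0 mul0r.
  by rewrite -mulrA {1}/n mulrBl wnn hnn subr0.
have /eqP := cube_eq0 na n3; rewrite subr_eq0 => /eqP <-.
exact: pw.
Qed.

Lemma pos_conj z a : pos a -> pos (adj z * a * z).
Proof.
move=> [h ha ->]; have := pos_adj_mul (h * z); rewrite adjM ha.
by rewrite !mulrA.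
Qed.

Lemma adj_mul_eq0 z : adj z * z = 0 -> z = 0.
Proof.
move/(congr1 (@unorm _ A)); rewrite unorm_cstar unorm0 => /eqP.
by rewrite expf_eq0 /= => /eqP /unorm_eq0.
Qed.

Lemma pos_emb x : pos (emb (star x ** x) : U).
Proof. by rewrite -embM -adj_emb; exact: pos_adj_mul. Qed.

End Positive.

(** * Decay, Neumann series and bumps *)

Section Bump.
Variables (R : realType) (A : cstarAlgType R).
Local Notation U := (unitization A).
Implicit Types (a b c d h k s z w : U) (P : set U) (t M : R).

Lemma posX a n : pos a -> pos (a ^+ n).
Proof.
move=> pa; elim: n => [|n IH]; first by rewrite expr0 -uscal1; exact: pos_uscal.
by rewrite exprS; apply: posM => //; apply: commrX.
Qed.

Lemma unormX_le1 a n : unorm a <= 1 -> unorm (a ^+ n) <= 1.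
Proof.
move=> a1; elim: n => [|n IH]; first by rewrite expr0 unorm1.
by rewrite exprS; apply: (le_trans (unormM _ _)); rewrite mulr_ile1 ?unorm_ge0.
Qed.

Lemma adjX a n : adj a = a -> adj (a ^+ n) = a ^+ n.
Proof.
move=> aa; elim: n => [|n IH]; first by rewrite expr0 adj1.
by rewrite {1}exprS adjM IH aa -exprSr.
Qed.

(** The inequality (1 + n c) (1 - c)^n <= 1 for 0 <= c <= 1, by induction: one step
lowers the left-hand side by (n + 1) c^2 (1 - c)^n. *)
Lemma pos_bernoulli c n : pos c -> pos (1 - c) ->
  pos (1 - ((1 - c) ^+ n + (n%:R)%:C *: (c * (1 - c) ^+ n))).
Proof.
move=> pc pd; set d := 1 - c in pd *.
have cd : GRing.comm c d by rewrite /GRing.comm mulrBl mulrBr mul1r mulr1.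
elim: n => [|n IH].
  by rewrite expr0 scale0r addr0 subrr; exact: pos0.
have -> : 1 - (d ^+ n.+1 + (n.+1%:R)%:C *: (c * d ^+ n.+1)) =
    1 - (d ^+ n + (n%:R)%:C *: (c * d ^+ n)) +
    (n.+1%:R)%:C *: (c * c * d ^+ n).
  rewrite -addrA; congr (_ + _); apply/eqP.
  rewrite eqr_oppLR opprD opprK; apply/eqP.
  have -> : d ^+ n.+1 = d ^+ n - c * d ^+ n by rewrite exprS mulrBl mul1r.
  rewrite mulrBr mulrA scalerBr addrA; congr (_ - _).
  rewrite -natr1 rmorphD /= scalerDl scale1r -!addrA; congr (_ + _).
  by rewrite addrC -addrA subrr addr0.
apply: posD => //; apply: pos_scale => //.
rewrite -mulrA; have cdn : GRing.comm c (d ^+ n) by exact: commrX.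
have pcd : pos (c * d ^+ n) by apply: posM => //; exact: posX.
by apply: posM => //; rewrite -mulrA -cdn.
Qed.

(** By the previous lemma n c (1 - c)^n is at most 1 - (1 - c)^n, hence at most 1. *)
Lemma decay c n : pos c -> pos (1 - c) ->
  n%:R * unorm (c * (1 - c) ^+ n) <= 1.
Proof.
move=> pc pd; have n0 : 0 <= n%:R :> R by [].
rewrite -{1}[n%:R]ger0_norm // -unormZr; apply: pos_unorm_le => //.
  apply: pos_scale => //; apply: posM => //; first exact: posX.
  by apply: commrX; rewrite /GRing.comm mulrBl mulrBr mul1r mulr1.
have := posD (pos_bernoulli n pc pd) (posX n pd).
by rewrite uscal1 opprD addrA addrAC subrK.
Qed.

(** With c = t z* z of norm at most 1, |z d|^2 = |d z* z d| is at most
|z|^2 |c (1 - c)^n|, which decays like 1 / n. *)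
Lemma approx_unit z e : 0 < e -> exists t n,
  let d := (1 - t%:C *: (adj z * z)) ^+ n in
  [/\ adj d = d, unorm d <= 1 & unorm (z * d) <= e].
Proof.
move=> e0; set q := unorm z ^+ 2; have q0 : 0 <= q by rewrite exprn_ge0 ?unorm_ge0.
have e2 : 0 < e ^+ 2 by rewrite exprn_gt0.
pose n := Num.bound (q / e ^+ 2); exists q^-1, n.
set c := _ *: _; move=> d.
have pc : pos c by apply: pos_scale; rewrite ?invr_ge0 //; exact: pos_adj_mul.
have cq : q%:C *: c = adj z * z.
  have [q00|qne] := eqVneq q 0; last by rewrite scalerA -rmorphM /= divff // scale1r.
  rewrite q00 scale0r; apply/esym/unorm_eq0; rewrite unorm_cstar; exact: q00.
have c1 : unorm c <= 1.
  rewrite unormZr unorm_cstar -/q ger0_norm ?invr_ge0 //.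
  by have [->|qne] := eqVneq q 0; rewrite ?mulr0 // mulVf.
have pd : pos (1 - c) by rewrite -uscal1; exact: pos_uscal_sub.
have d1 : unorm d <= 1 by apply: unormX_le1; rewrite -uscal1; exact: pos_uscal_sub_le.
have da : adj d = d by apply: adjX; exact: pos_sa.
split=> //; rewrite -(@ler_sqr _ (unorm _)) ?nnegrE ?unorm_ge0 ?(ltW e0) //.
rewrite -unorm_cstar adjM da -mulrA [adj z * _]mulrA -cq -scalerAl -scalerAr.
rewrite unormZr ger0_norm //.
have h1 : unorm (d * (c * d)) <= unorm (c * d).
  by apply: (le_trans (unormM _ _)); rewrite ler_piMl ?unorm_ge0.
have h2 := decay n pc pd; rewrite -/d in h2.
have h3 : q < n%:R * e ^+ 2.
  rewrite -ltr_pdivrMr //; apply: archi_boundP.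
  by rewrite divr_ge0 // ltW.
have x0 := unorm_ge0 (c * d).
apply: (le_trans (ler_wpM2l q0 h1)).
apply: (le_trans (ler_wpM2r x0 (ltW h3))).
by rewrite mulrAC ler_piMl // ltW.
Qed.

Fixpoint neumann a n : U := if n is m.+1 then 1 + a * neumann a m else 0.

Fixpoint neumann_majorant (r : R) n : R :=
  if n is m.+1 then 1 + r * neumann_majorant r m else 0.

(** The inverse is the geometric series.  Its partial sums are the iterates of
v := 1 + a v, and are majorized by the same recursion on reals. *)
Lemma neumann_inverse a (r : R) : unorm a <= r -> r < 1 -> exists v,
  [/\ (1 - a) * v = 1, v * (1 - a) = 1, unorm v <= (1 - r)^-1
    & forall P, closed_subalg P -> P a -> P v].
Proof.
move=> ar r1; have r0 : 0 <= r := le_trans (unorm_ge0 _) ar.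
have r1' : 0 < 1 - r by rewrite subr_gt0.
have mb n : 0 <= neumann_majorant r n <= (1 - r)^-1.
  elim: n => [|n /andP[h1 h2]] /=; first by rewrite lexx invr_ge0 ltW.
  rewrite addr_ge0 ?mulr_ge0 //=.
  have -> : (1 - r)^-1 = 1 + r * (1 - r)^-1.
    by apply: (mulIf (lt0r_neq0 r1')); rewrite mulrDl -mulrA mulVf ?lt0r_neq0 //; ring.
  by rewrite lerD2l ler_wpM2l.
have bd n : unorm (neumann a n) <= neumann_majorant r n.
  elim: n => [|n IH] /=; first by rewrite unorm0.
  apply: (le_trans (unormD _ _)); rewrite unorm1 lerD2l.
  by apply: (le_trans (unormM _ _)); rewrite ler_pM ?unorm_ge0.
have step n : unorm (neumann a n.+1 - neumann a n) <=
    neumann_majorant r n.+1 - neumann_majorant r n.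
  elim: n => [|n IH]; first by rewrite /= !mulr0 !addr0 !subr0 unorm1.
  have -> : neumann a n.+2 - neumann a n.+1 =
      a * (neumann a n.+1 - neumann a n).
    by rewrite mulrBr /= opprD addrACA subrr add0r.
  have -> : neumann_majorant r n.+2 - neumann_majorant r n.+1 =
      r * (neumann_majorant r n.+1 - neumann_majorant r n).
    by rewrite mulrBr /= opprD addrACA subrr add0r.
  by apply: (le_trans (unormM _ _)); rewrite ler_pM ?unorm_ge0.
have /complete_unorm[v uv] : cauchy_sequence (@unorm _ A) (neumann a).
  apply: (majorized_cauchy (v := neumann_majorant r) (t := (1 - r)^-1)) => //.
  by move=> n; case/andP: (mb n).
have vP P : closed_subalg P -> P a -> P v.
  move=> hP Pa; have [_ hD hM hC] := hP; apply: hC.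
  apply: (tends_to_adherent uv); elim=> [|n IH] /=; first exact: closed_subalg0.
  by apply: hD; [exact: closed_subalg1 | exact: hM].
have va : v * a = a * v by apply: (vP _ (closed_subalg_comm a)).
have vE : v = 1 + a * v.
  apply/eqP; rewrite -subr_eq0; apply/eqP.
  apply: (@unorm_small _ _ _ 2) => e /uv[N hN].
  have -> : v - (1 + a * v) =
      (v - neumann a N.+1) + a * (neumann a N - v).
    by rewrite mulrBr /= !opprD !addrA subrK.
  apply: (le_trans (unormD _ _)); rewrite unormB.
  have h1 : unorm (neumann a N.+1 - v) <= e by exact: hN.
  have h2 : unorm (neumann a N - v) <= e by exact: hN.
  have := unormM a (neumann a N - v).
  have := ler_pM (unorm_ge0 _) (unorm_ge0 _) (le_trans ar (ltW r1)) h2.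
  lra.
have e1 : (1 - a) * v = 1 by rewrite mulrBl mul1r {1}vE addrK.
exists v; split=> //.
- by rewrite mulrBr mulr1 va {1}vE addrK.
- apply: (tends_to_le uv) => n; apply: (le_trans (bd n)).
  by case/andP: (mb n).
Qed.

(** With z = h - 1/2, take y = |z| + z, twice the positive part of z, and let m be
the inverse of M0 = (h + 1/2 + |z|) / 2 = max(h, 1/2).  Since h and M0 differ by
a multiple of |z| - z, which annihilates y, they agree on y, so m inverts h
there.  The Neumann series for M0 = 1/4 + (positive) gives |m| <= 4. *)
Lemma bump h : pos h -> unorm h = 1 -> exists m y,
  [/\ adj m = m, adj y = y, unorm m <= 4, h * y != 0 & m * h * (h * y) = h * y]
  /\ forall P, closed_subalg P -> P h -> P m /\ P y.
Proof.
move=> ph h1; have ha := pos_sa ph; set z := h - uscal 2^-1.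
have za : adj z = z by rewrite adjD adjN adj_uscal ha.
have [w [ww pw wP]] := abs_ex za; have wa := pos_sa pw.
have hz : z * h = h * z by rewrite mulrBl mulrBr uscalE -scalerAl -scalerAr mul1r mulr1.
have wh : w * h = h * w by apply: (wP _ (closed_subalg_comm h)).
have wz : w * z = z * w by apply: (wP _ (closed_subalg_comm z)).
set y := w + z; have ya : adj y = y by rewrite adjD wa za.
have hy : h * y = y * h by rewrite /y mulrDr mulrDl wh hz.
have ny : (w - z) * y = 0.
  have e (u v : U) : u * v = v * u -> u * u = v * v -> (u - v) * (u + v) = 0.
    move=> uv uu; rewrite mulrBl !mulrDr uu uv opprD [- _ - _]addrC addrACA.
    by rewrite !subrr addr0.
  exact: e.
set p := (2^-1)%:C *: (h + w).
have pp : pos p by apply: pos_scale; rewrite ?invr_ge0 //; exact: posD.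
(* M0 = 1/4 + p, where p is positive. *)
have hp : h = uscal 4^-1 + p - (2^-1)%:C *: (w - z).
  rewrite -addrA -scalerBr.
  have -> : h + w - (w - z) = h + h - uscal 2^-1.
    by rewrite opprB addrACA subrr addr0 addrA.
  rewrite scalerBr addrr_scale scalerA -rmorphM /= mulVf // scale1r scale_uscal.
  have -> : 2^-1 * 2^-1 = 4^-1 :> R by rewrite -invfM -natrM.
  by rewrite addrC subrK.
set K := unorm p; have K0 : 0 <= K := unorm_ge0 _.
set q := K + 4^-1; have qp : 0 < q by rewrite /q; lra.
set a := (q^-1)%:C *: (uscal K - p).
have ra : unorm a <= K / q.
  rewrite unormZr ger0_norm ?invr_ge0 ?(ltW qp) // mulrC ler_wpM2r ?invr_ge0 ?(ltW qp) //.
  exact: pos_uscal_sub_le.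
have r1 : K / q < 1 by rewrite ltr_pdivrMr // /q; lra.
have [v [v1 v2 vn vP]] := neumann_inverse ra r1.
have aE : q%:C *: (1 - a) = uscal 4^-1 + p.
  rewrite scalerBr /a scalerA -rmorphM /= divff ?lt0r_neq0 // scale1r -uscalE /q uscalD.
  by rewrite opprB addrA addrAC [uscal K + _]addrC addrK.
have e1 : h * y = (uscal 4^-1 + p) * y.
  by rewrite [in LHS]hp [LHS]mulrBl -scalerAl ny scaler0 subr0.
have aa : adj a = a by rewrite adjZr adjD adjN adj_uscal (pos_sa pp).
have va : adj v = v.
  have := congr1 (@adj _ A) v1; rewrite adjM adjD adjN aa adj1 => h2.
  by rewrite -[LHS]mulr1 -v1 mulrA h2 mul1r.
exists ((q^-1)%:C *: v), y; split.
  split=> //.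
  - by rewrite adjZr va.
  - rewrite unormZr ger0_norm ?invr_ge0 ?(ltW qp) //.
    rewrite mulrC ler_pdivrMr //; apply: (le_trans vn).
    rewrite (_ : 1 - K / q = 4^-1 / q); last first.
      by rewrite -[X in X - _](divff (lt0r_neq0 qp)) -mulrBl /q addrAC subrr add0r.
    by rewrite invf_div invrK mulrC.
  (* If h y = 0 then w y = - y / 2, so y w y is both positive and negative; thus
     y = 0, w = 1/2 - h is positive and h has norm at most 1/2. *)
  - apply/eqP => hy0.
    have zy : z * y = - ((2^-1)%:C *: y).
      by rewrite mulrBl hy0 sub0r uscalE -scalerAl mul1r.
    have wy : w * y = - ((2^-1)%:C *: y).
      by rewrite -zy; apply/eqP; rewrite -subr_eq0 -mulrBl ny.
    have yy : (2^-1)%:C *: (y * y) = 0.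
      apply: pos_anti; first by apply: pos_scale; rewrite ?invr_ge0 //; exact: pos_sq.
      have := pos_conj y pw; rewrite ya -mulrA wy mulrN -scalerAr.
      by [].
    have /eqP := yy; rewrite scaler_eq0 => /orP[/eqP|/eqP yy0].
      by move=> /(@complexI R) h2; exfalso; lra.
    have y0 : y = 0 by apply: adj_mul_eq0; rewrite ya.
    have wE : w = uscal 2^-1 - h.
      by apply/eqP; rewrite -subr_eq0 opprB -/z -/y y0.
    have := pos_unorm_le _ ph; rewrite h1 => /(_ 2^-1); rewrite -wE.
    have h20 : 0 <= 2^-1 :> R by rewrite invr_ge0.
    by move=> /(_ h20 pw); lra.
  rewrite hy mulrA -(mulrA _ h y); congr (_ * _).
  rewrite e1 -aE -scalerAl -scalerAl -scalerAr.
  by rewrite scalerA -rmorphM /= mulVf ?lt0r_neq0 // scale1r mulrA v2 mul1r.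
move=> P hP Ph; have [Pc PD PM _] := hP.
have Pz : P z by apply: closed_subalgB => //; apply: Pc.
have Pw : P w by exact: wP.
split; last exact: PD.
apply: closed_subalgZ => //; apply: vP => //; apply: closed_subalgZ => //.
by apply: closed_subalgB => //; [exact: Pc | apply: closed_subalgZ => //; exact: PD].
Qed.

End Bump.

(** * Uniqueness of the C*-norm *)

Section ClosedSubspace.
Variables (R : realType) (A : cstarAlgType R).
Implicit Types (S : set A) (x y : A).

Lemma closed_subspaceP S : closed_subspace S <->
  [/\ S 0, forall (c : R[i]) x y, S x -> S y -> S (c *: x + y)
    & forall x, (forall e, 0 < e -> exists2 y, S y & rnorm (x - y) <= e) -> S x].
Proof.
split=> [[[S0 SD] Sc]|[S0 SD Sc]].
  split=> [|c x y Sx Sy|].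
  - by move: S0; rewrite inE.
  - by have := SD c x y; rewrite !inE; apply.
  - exact: closed_adherent.
split; last exact: adherent_closed.
by split=> [|c x y]; rewrite !inE // => Sx Sy; apply: SD.
Qed.

Variable S : set A.
Hypothesis hS : closed_subspace S.

Lemma closed_subspace0 : S 0. Proof. by case/closed_subspaceP: hS. Qed.

Lemma closed_subspaceD x y : S x -> S y -> S (x + y).
Proof.
have /closed_subspaceP[_ h _] := hS.
by move=> Sx Sy; rewrite -(scale1r x); exact: h.
Qed.

Lemma closed_subspaceZ (c : R[i]) x : S x -> S (c *: x).
Proof.
have /closed_subspaceP[h0 h _] := hS.
by move=> Sx; rewrite -[_ *: _]addr0; exact: h.
Qed.

Lemma closed_subspaceN x : S x -> S (- x).
Proof. by rewrite -scaleN1r; exact: closed_subspaceZ. Qed.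

End ClosedSubspace.

(** How to get rid of a multiplicative constant: apply the hypothesis to the
iterated squares of x and take roots. *)
Lemma le_of_squares (R : realType) (T : Type) (Q : T -> Prop) (sq : T -> T)
    (f g : T -> R) (K : R) : 0 <= K ->
  (forall x, Q x -> Q (sq x)) -> (forall x, Q x -> 0 <= f x) ->
  (forall x, Q x -> 0 <= g x) ->
  (forall x, Q x -> f x ^+ 2 <= f (sq x)) ->
  (forall x, Q x -> g (sq x) = g x ^+ 2) ->
  (forall x, Q x -> f x <= K * g x) -> forall x, Q x -> f x <= g x.
Proof.
move=> K0 Qsq f0 g0 fsq gsq fg x Qx.
have Qk k : Q (iter k sq x) by elim: k => //= k; exact: Qsq.
have fk k : f x ^+ (2 ^ k) <= f (iter k sq x).
  elim: k => [|k IH]; first by rewrite expn0 expr1.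
  rewrite expnS mulnC exprM; apply: le_trans (fsq _ (Qk k)).
  by rewrite lerXn2r ?nnegrE ?exprn_ge0 ?f0.
have gk k : g (iter k sq x) = g x ^+ (2 ^ k).
  elim: k => [|k IH]; first by rewrite expn0 expr1.
  by rewrite expnS mulnC exprM -IH /= gsq.
apply: (@le_of_pow2_le _ _ _ K); rewrite ?f0 ?g0 // => k.
apply: (le_trans (fk k)); apply: (le_trans (fg _ (Qk k))).
by rewrite gk ler_wpM2r ?exprn_ge0 ?g0 // ler_peMr // ler1n.
Qed.

Section NormUniqueness.
Variables (R : realType) (A : cstarAlgType R) (S : set A).
Hypothesis hS : cstar_subalgebra S.
Local Notation U := (unitization A).

Let hSs : closed_subspace S. Proof. by case: hS. Qed.

(** The unitization of S inside that of A. *)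
Definition unital_hull : set U := [set z | S z.2].

Lemma closed_subalg_unital_hull : closed_subalg unital_hull.
Proof.
have [_ SM _] := hS; split=> [c|z w|z w|z h]; rewrite /unital_hull /=.
- by rewrite scaler0; exact: closed_subspace0.
- exact: closed_subspaceD.
- move=> Sz Sw; apply: closed_subspaceD => //; last exact: SM.
  by apply: closed_subspaceD => //; exact: closed_subspaceZ.
have /closed_subspaceP[_ _ Sc] := hSs; apply: Sc => e e0.
have e2 : 0 < e / 2 by rewrite divr_gt0.
have [w Sw zw] := h _ e2; exists w.2 => //.
apply: (le_trans (rnorm_snd_le (z - w))); lra.
Qed.

Lemma unital_hull_act z y : unital_hull z -> S y -> S (act z y).
Proof.
have [_ SM _] := hS; move=> Sz Sy; apply: closed_subspaceD => //.
  exact: closed_subspaceZ.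
exact: SM.
Qed.

Variable p : A -> R.
Hypothesis p_ge0 : forall x, S x -> 0 <= p x.
Hypothesis pZ : forall c x, S x -> p (c *: x) = rnorm c * p x.
Hypothesis pD : forall x y, S x -> S y -> p (x + y) <= p x + p y.
Hypothesis pM : forall x y, S x -> S y -> p (x ** y) <= p x * p y.
Hypothesis pC : forall x, S x -> p (star x ** x) = p x ^+ 2.
Hypothesis p_eq0 : forall x, S x -> p x = 0 -> x = 0.

(** The C*-identity for p gives p(u y)^2 = p(y* u* u y) = p(y)^2. *)
Lemma seminorm_isometry u y : unital_hull u -> adj u * u = 1 -> S y -> p (act u y) = p y.
Proof.
move=> Su uu Sy.
have : p (act u y) ^+ 2 = p y ^+ 2.
  rewrite -!pC //; last exact: unital_hull_act.
  rewrite -[in star _](adjK u) -act_adj -actM uu.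
  by rewrite /act scale1r cmul0l addr0.
by apply: pexpIrn; rewrite ?nnegrE ?p_ge0 //; exact: unital_hull_act.
Qed.

(** With k the square root of 1 - z^2, both z + ik and z - ik are isometric for p,
and z is their mean. *)
Lemma seminorm_contraction z y : adj z = z -> unital_hull z -> unorm z <= 1 -> S y ->
  p (act z y) <= p y.
Proof.
move=> za Sz z1 Sy; have [hC hD hM _] := closed_subalg_unital_hull.
have zza : adj (z * z) = z * z by rewrite adjM za.
have zz1 : unorm (z * z) <= 1 by rewrite unorm_sa // expr_le1 ?unorm_ge0.
have [k [kk ka _ kP]] := sqrt_one_sub zza zz1.
have kz : k * z = z * k by apply: (kP _ (closed_subalg_comm z)); rewrite /= mulrA.
have Sk : unital_hull k by apply: kP; [exact: closed_subalg_unital_hull | exact: hM].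
have iso w : adj w = w -> w * z = z * w -> w * w = k * k -> unital_hull w ->
    p (act (z + 'i%C *: w) y) = p y.
  move=> wa wz ww Sw; apply: seminorm_isometry => //.
    by apply: hD => //; apply: closed_subalgZ => //; exact: closed_subalg_unital_hull.
  by rewrite adj_mul_add_i // ww kk addrC subrK.
have h1 := iso k ka kz erefl Sk.
have h2 : p (act (z + 'i%C *: (- k)) y) = p y.
  apply: iso; rewrite ?adjN ?ka ?mulrNN ?mulNr ?mulrN ?kz //.
  by rewrite -scaleN1r; apply: closed_subalgZ => //; exact: closed_subalg_unital_hull.
have Sw w : unital_hull w -> S (act (z + 'i%C *: w) y).
  move=> hw; apply: unital_hull_act => //; apply: hD => //.
  by apply: closed_subalgZ => //; exact: closed_subalg_unital_hull.
have SNk : unital_hull (- k).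
  by rewrite -scaleN1r; apply: closed_subalgZ => //; exact: closed_subalg_unital_hull.
have := pD (Sw _ Sk) (Sw _ SNk).
rewrite h1 h2 -actD addrACA -scalerDr subrr scaler0 addr0.
by rewrite addrr_scale actZ pZ ?rnorm_real ?ger0_norm //; [lra | exact: unital_hull_act].
Qed.

Lemma seminorm_act z y : adj z = z -> unital_hull z -> S y ->
  p (act z y) <= unorm z * p y.
Proof.
move=> za Sz Sy; have [z0|zn] := eqVneq (unorm z) 0.
  rewrite z0 (unorm_eq0 z0) mul0r.
  have -> : act 0 y = 0 *: y by rewrite /act cmul0l addr0.
  by rewrite pZ // rnorm0 mul0r.
have zp : 0 < unorm z by rewrite lt_def zn unorm_ge0.
have zE : z = (unorm z)%:C *: (((unorm z)^-1)%:C *: z).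
  by rewrite scalerA -rmorphM /= divff // scale1r.
rewrite {1}zE actZ pZ; last first.
  by apply: unital_hull_act => //; apply: closed_subalgZ => //; exact: closed_subalg_unital_hull.
rewrite rnorm_real ger0_norm ?unorm_ge0 // ler_wpM2l ?unorm_ge0 //.
apply: seminorm_contraction => //.
- by rewrite adjZr za.
- by apply: closed_subalgZ => //; exact: closed_subalg_unital_hull.
- by rewrite unormZr ger0_norm ?invr_ge0 ?unorm_ge0 // mulVf.
Qed.

(** For h = x* x, p(h)^2 = p(h h) is at most |h| p(h). *)
Lemma cstar_norm_le x : S x -> p x <= rnorm x.
Proof.
have [_ SM SC] := hS; move=> Sx; set h := star x ** x.
have Sh : S h by apply: SM => //; exact: SC.
have hh : star h = h by rewrite /h starM starK.
have : p h ^+ 2 <= rnorm h * p h.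
  rewrite -pC // hh -act_emb -(unorm_emb h); apply: seminorm_act => //.
  by rewrite adj_emb hh.
rewrite pC // rnorm_star_cmul.
have := p_ge0 Sx; have := rnorm_ge0 x; move: (p x) (rnorm x) => s t t0 s0 st.
rewrite leNgt; apply/negP => ts.
have s2 : 0 < s ^+ 2 by rewrite exprn_gt0 //; exact: le_lt_trans ts.
move: st; rewrite expr2 ler_pM2r //.
by rewrite leNgt ltrXn2r.
Qed.

(** Otherwise h = x* x, normalized, has p(h) < 1/8.  A bump y' = h y for h satisfies
y' = m h y' with |m| <= 4, so p(y') <= 4 p(h) p(y') <= p(y') / 2, and y' = 0 by
definiteness. *)
Lemma rnorm_sq_le_cstar_norm x : S x -> rnorm x ^+ 2 <= 8 * p x ^+ 2.
Proof.
have [_ SM SC] := hS; move=> Sx; rewrite leNgt; apply/negP => lt.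
have xp : 0 < rnorm x ^+ 2 by apply: le_lt_trans lt; rewrite mulr_ge0 // exprn_ge0 ?p_ge0.
set t := rnorm x ^+ 2 in lt xp.
set h := (t^-1)%:C *: (star x ** x).
have Sxx : S (star x ** x) by apply: SM => //; exact: SC.
have Sh : S h by exact: closed_subspaceZ.
have ph : p h < 8^-1.
  rewrite pZ // pC // rnorm_real ger0_norm ?invr_ge0 ?(ltW xp) //.
  by rewrite mulrC ltr_pdivrMr // mulrC ltr_pdivlMr // mulrC.
have posh : pos (emb h : U).
  by rewrite embZ; apply: pos_scale; rewrite ?invr_ge0 ?(ltW xp) //; exact: pos_emb.
have h1 : unorm (emb h : U) = 1.
  rewrite unorm_emb rnormZ rnorm_star_cmul -/t rnorm_real ger0_norm ?invr_ge0 ?(ltW xp) //.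
  by rewrite mulVf ?lt0r_neq0.
have [m [y [[ma ya m4 hy0 mhy] mP]]] := bump posh h1.
have [Sm Sy] := mP _ closed_subalg_unital_hull Sh.
set y' := y.1 *: h + h ** y.2.
have Sy' : S y'.
  by apply: closed_subspaceD => //; [exact: closed_subspaceZ | exact: SM].
have yE : emb h * y = emb y' by exact: emb_mul.
have my : act m (h ** y') = y'.
  apply: emb_inj; rewrite -mul_emb -embM -yE mulrA; exact: mhy.
have y'0 : y' != 0 by apply: contraNneq hy0 => y0; rewrite yE y0.
have /negP := y'0; apply; apply/eqP; apply: p_eq0 => //.
have Shy : S (h ** y') by exact: SM.
have h2 := seminorm_act ma Sm Shy; rewrite my in h2.
have h3 := pM Sh Sy'; have h4 := p_ge0 Sy'.
have h5 := ler_pM (unorm_ge0 m) (p_ge0 Shy) m4 h3.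
have h6 := ler_wpM2r h4 (ltW ph).
by apply/le_anti; rewrite h4 andbT; lra.
Qed.

(** The upper bound is [cstar_norm_le]; the lower bound holds up to the constant
8 by [rnorm_sq_le_cstar_norm], and iterated squares remove the constant. *)
Lemma cstar_norm_unique x : S x -> p x = rnorm x.
Proof.
have [_ SM SC] := hS; move=> Sx; apply/le_anti; rewrite cstar_norm_le //=.
apply: (@le_of_squares R A S (fun x => star x ** x) _ _ 8) Sx => //.
- by move=> y Sy; apply: SM => //; exact: SC.
- by move=> y _; exact: rnorm_ge0.
- by move=> y _; rewrite rnorm_star_cmul.
move=> y Sy; rewrite -(@ler_sqr _ (rnorm y)) ?nnegrE ?rnorm_ge0 ?mulr_ge0 ?p_ge0 //.
apply: (le_trans (rnorm_sq_le_cstar_norm Sy)); rewrite exprMn ler_wpM2r ?exprn_ge0 ?p_ge0 //.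
by rewrite -natrX ler_nat.
Qed.

End NormUniqueness.

(** * Hereditary subalgebras *)

Section Corner.
Variables (R : realType) (A : cstarAlgType R) (S : set A).
Hypothesis hS : cstar_subalgebra S.
Local Notation U := (unitization A).
Implicit Types (D : set A) (x y h g : A).

Lemma nonzero_positive D : cstar_subalgebra D -> nonzero_set D ->
  exists2 x, positive_in D x & rnorm x = 1.
Proof.
move=> [Ds DM DC] [z Dz z0].
have zp : 0 < rnorm z.
  by rewrite lt_def rnorm_ge0 andbT; apply: contraNneq z0 => /rnorm_eq0 ->.
set w := ((rnorm z)^-1)%:C *: z; exists (star w ** w).
  by exists w => //; exact: closed_subspaceZ.
rewrite rnorm_star_cmul rnormZ rnorm_real ger0_norm ?invr_ge0 ?rnorm_ge0 //.
by rewrite mulVf ?lt0r_neq0 // expr1n.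
Qed.

Lemma positive_in_sub D x : cstar_subalgebra D -> positive_in D x ->
  [/\ D x, star x = x & pos (emb x : U)].
Proof.
move=> [Ds DM DC] [w Dw <-]; split; last exact: pos_emb.
  by apply: DM => //; exact: DC.
by rewrite starM starK.
Qed.

Lemma hereditary_self : hereditary_subalgebra S S.
Proof.
split=> // a b pa pb [w Sw /eqP]; rewrite eq_sym subr_eq => /eqP e.
by case: pb => v Sv <-; have [_ SM SC] := hS; apply: SM => //; exact: SC.
Qed.

(** The largest subalgebra of D on which g acts as a unit. *)
Definition corner g D := [set x | [/\ D x, g ** x = x & x ** g = x]].

(** If b <= a with a in the corner and q = 1 - g, then q a q = 0 forces q b q = 0.
Writing b = v* v, this gives v q = 0. *)
Lemma hereditary_corner g D : hereditary_subalgebra D S -> star g = g ->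
  hereditary_subalgebra (corner g D) S.
Proof.
move=> [[Ds DM DC] DS Dher] gg.
have [D0 Dlin Dcl] := (closed_subspaceP D).1 Ds.
split.
- split.
  + apply/closed_subspaceP; split.
    * by split; rewrite ?cmul0r ?cmul0l.
    * move=> c x y [Dx gx xg] [Dy gy yg]; split; first exact: Dlin.
        by rewrite cmulDr cmulZr gx gy.
      by rewrite cmulDl cmulZl xg yg.
    move=> x h; have fix_of (f : A -> A) : {morph f : x y / x - y} ->
        (forall y, rnorm (f y) <= rnorm g * rnorm y) ->
        (forall y, corner g D y -> f y = y) -> f x = x.
      move=> fB fle fD; apply/eqP; rewrite -subr_eq0; apply/eqP/rnorm_eq0/le_anti.
      rewrite rnorm_ge0 andbT; apply: le_addgt0 => e e0; rewrite add0r.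
      have gp : 0 < rnorm g + 1 by rewrite ltr_wpDl ?rnorm_ge0.
      have [y Dy xy] := h _ (divr_gt0 e0 gp).
      have -> : f x - x = f (x - y) + (y - x) by rewrite fB (fD y Dy) addrA subrK.
      apply: (le_trans (rnormD _ _)); rewrite (rnormB y).
      have := fle (x - y); have := ler_wpM2l (rnorm_ge0 g) xy.
      have : (rnorm g + 1) * (e / (rnorm g + 1)) = e by rewrite mulrC divfK // lt0r_neq0.
      by move: (e / _) xy => s; nra.
    split.
    * by apply: Dcl => e /h[y [Dy _ _]]; exists y.
    * apply: (fix_of (fun x => g ** x)); last by move=> y [].
        by move=> a b; rewrite cmulDr cmulNr.
      by move=> y; exact: rnorm_cmul.
    * apply: (fix_of (fun x => x ** g)); last by move=> y [].
        by move=> a b; rewrite cmulDl cmulNl.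
      by move=> y; rewrite mulrC; exact: rnorm_cmul.
  + move=> x y [Dx gx xg] [Dy gy yg]; split; first exact: DM.
      by rewrite cmulA gx.
    by rewrite -cmulA yg.
  + move=> x [Dx gx xg]; split; first exact: DC.
      by rewrite -[in LHS]gg -starM xg.
    by rewrite -[in LHS]gg -starM gx.
- by move=> x [Dx _ _]; exact: DS.
move=> a b [x [Dx gx xg] ax] pb pab.
have Db : D b by apply: Dher pb pab; exists x.
case: pb => v Sv bE; case: pab => w Sw abE.
have [q [qa aq bq]] : exists q : U,
    [/\ adj q = q, emb a * q = 0 & emb b * q = emb b - emb b * emb g].
  exists (1 - emb g); split; first by rewrite adjD adjN adj1 adj_emb gg.
    by rewrite mulrBr mulr1 embM -ax -cmulA xg subrr.
  by rewrite mulrBr mulr1.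
have vq : adj (emb v * q) * (emb v * q) = q * emb b * q.
  by rewrite adjM qa adj_emb !mulrA -(mulrA q) embM bE.
have bq0 : q * emb b * q = 0.
  apply: pos_anti; first by rewrite -vq; exact: pos_adj_mul.
  have -> : - (q * emb b * q) = adj q * emb (star w ** w) * q.
    rewrite abE qa embD embN mulrDr mulrDl.
    by rewrite -(mulrA q (emb a)) aq mulr0 add0r mulrN mulNr.
  by apply: pos_conj; exact: pos_emb.
have vq0 : emb v * q = 0 by apply: adj_mul_eq0; rewrite vq.
have bg : b ** g = b.
  apply: (@emb_inj R A); apply/esym/eqP; rewrite -subr_eq0 -embM.
  by rewrite -bq -bE -embM -mulrA vq0 mulr0.
split=> //; have bb : star b = b by rewrite -bE starM starK.
by rewrite -[in LHS]gg -{1}bb -starM bg.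
Qed.

(** Let g = m h with m from the bump lemma for h; h y lies in the corner of g.
For x in that corner x = g x = x g, so x b x = x m (h b h) m x and x = m h x.
The first identity transports smallness of h b h to the whole corner, the
second bounds h below on it. *)
Lemma corner_of D h : hereditary_subalgebra D S -> D h -> star h = h ->
    pos (emb h : U) -> rnorm h = 1 ->
  exists D', [/\ hereditary_subalgebra D' S, D' `<=` D, nonzero_set D',
    forall b x, D' x -> rnorm (x ** b ** x) <= 16 * rnorm (h ** b ** h) * rnorm x ^+ 2
  & forall x, D' x -> rnorm x <= 4 * rnorm (h ** x)].
Proof.
move=> hD Dh hh ph h1; have [hDs DS _] := hD.
have [Ds DM DC] := hDs.
have [|m [y [[ma ya m4 hy0 mhy] mP]]] := bump ph; first by rewrite unorm_emb.
have [Dm Dy] := mP _ (closed_subalg_unital_hull hDs) Dh.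
have [mh yh] := mP _ (closed_subalg_comm (emb h)) erefl.
rewrite /= in mh yh.
set g := act m h; have gE : emb g = m * emb h by rewrite mul_emb.
have gg : star g = g.
  by apply: (@emb_inj R A); rewrite -adj_emb gE adjM ma adj_emb hh mh.
exists (corner g D); split.
- exact: hereditary_corner.
- by move=> x [].
- exists (y.1 *: h + h ** y.2); last first.
    by apply: contraNneq hy0 => y0; rewrite emb_mul y0.
  split.
  + apply: closed_subspaceD => //; first exact: closed_subspaceZ.
    exact: DM.
  + by apply: (@emb_inj R A); rewrite -embM -emb_mul gE.
  + apply: (@emb_inj R A); rewrite -embM -emb_mul gE.
    have := congr1 (@adj _ A) mhy; rewrite !adjM adj_emb hh ya ma => e.
    by rewrite -yh mh.
- move=> b x [_ gx xg].
  have gbg : rnorm (g ** b ** g) <= 16 * rnorm (h ** b ** h).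
    rewrite -[rnorm (g ** b ** g)](unorm_emb) -!embM gE {2}mh.
    rewrite -!mulrA [emb h * (emb b * _)]mulrA.
    rewrite [emb h * emb b * _]mulrA 2!embM.
    apply: (le_trans (unormM _ _)).
    have h3 := unormM (emb (h ** b ** h)) m; rewrite unorm_emb in h3.
    have m0 := unorm_ge0 m.
    have h4 := ler_wpM2l m0 h3.
    apply: (le_trans h4).
    have : unorm m ^+ 2 <= 4 ^+ 2 by rewrite lerXn2r ?nnegrE.
    by have := rnorm_ge0 (h ** b ** h); move: (rnorm _) (unorm m) => s t; nra.
  have -> : x ** b ** x = x ** (g ** b ** g) ** x.
    by rewrite -{1}xg -{2}gx !cmulA.
  apply: (le_trans (rnorm_cmul _ _)).
  have := rnorm_cmul x (g ** b ** g); have := rnorm_ge0 x.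
  have := rnorm_ge0 (g ** b ** g).
  move: (rnorm (g ** _ ** g)) (rnorm (h ** _ ** h)) (rnorm x) (rnorm (x ** _)) gbg => s t u v.
  move=> st s0 u0 vu; rewrite expr2 mulrA ler_wpM2r //.
  by apply: (le_trans vu); rewrite mulrC ler_wpM2r.
move=> x [_ gx _].
have -> : rnorm x = unorm (m * emb (h ** x) : U).
  by rewrite -embM mulrA -gE embM gx unorm_emb.
apply: (le_trans (unormM _ _)); rewrite unorm_emb ler_wpM2r ?rnorm_ge0 //.
Qed.

End Corner.

(** * The direct sum of a Fell bundle *)

Section DirectSum.
Variables (R : realType) (G : groupType) (A : cstarAlgType R) (B : G -> set A).
Hypothesis hB : fell_bundle B.
Local Notation e := (1%g : G).
Local Notation U := (unitization A).
Implicit Types (a b f : G -> A) (x y : A) (s t : G).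

Let Bs t : closed_subspace (B t). Proof. by case: hB. Qed.

Lemma fiber_star t x : B t x -> B (t^-1)%g (star x).
Proof. by case: hB => _ <- _ Bx; exists x. Qed.

Lemma fiber_mul t s x y : B t x -> B s y -> B (t * s)%g (x ** y).
Proof. by case: hB => _ _; apply. Qed.

Lemma cstar_subalgebra_fiber1 : cstar_subalgebra (B e).
Proof.
split=> [|x y Bx By|x Bx]; first exact: Bs.
  by rewrite -[e]mulg1; exact: fiber_mul.
by rewrite -[e]invg1; exact: fiber_star.
Qed.

(** The element x of the fibre at t as a section; at the unit of G it is
[ds_unit_fiber] of the same element. *)
Definition single t x : G -> A := fun s => if s == t then x else 0.

Lemma fsum_single (F : G -> A) t : (forall s, s != t -> F s = 0) ->
  \sum_(s \in [set: G]) F s = F t.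
Proof.
move=> h; rewrite (fsbigTE [fset t]%fset) ?big_seq_fset1 // => s.
by rewrite in_fset1; exact: h.
Qed.

Lemma fiber_fsum t (F : G -> A) : (forall s, B t (F s)) ->
  B t (\sum_(s \in [set: G]) F s).
Proof.
move=> BF; apply: (@big_ind A (B t)) => //; first exact: closed_subspace0.
by move=> x y; exact: closed_subspaceD.
Qed.

Lemma ds_ext a b : (forall t, a t = b t) -> a = b.
Proof. by move=> h; apply/funext. Qed.

Lemma direct_sum_single t x : B t x -> direct_sum B (single t x).
Proof.
move=> Bx; split=> [s|].
  rewrite /single; have [->//|_] := eqVneq s t; exact: closed_subspace0.
apply: (@sub_finite_set _ _ [set t]) => // s /=.
by rewrite /single; have [->//|_] := eqVneq s t; rewrite eqxx.
Qed.

Lemma direct_sumZ (c : R[i]) a : direct_sum B a -> direct_sum B (c *: a).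
Proof.
move=> [Ba fa]; split=> [t|]; first exact: closed_subspaceZ.
apply: (sub_finite_set _ fa) => t /=; apply: contraNneq => a0.
by rewrite -[(c *: a) t]/(c *: a t) a0 scaler0.
Qed.

Lemma direct_sum_star a : direct_sum B a -> direct_sum B (ds_star a).
Proof.
move=> [Ba fa]; split=> [t|].
  by rewrite /ds_star -{1}[t]invgK; exact: fiber_star.
apply: (sub_finite_set _ (finite_image (fun t : G => t^-1)%g fa)) => t /= h.
exists (t^-1)%g; rewrite ?invgK //=.
by apply: contraNneq h => a0; rewrite /ds_star a0 star0.
Qed.

Lemma direct_sum_mul a b : direct_sum B a -> direct_sum B b ->
  direct_sum B (ds_mul a b).
Proof.
move=> [Ba fa] [Bb fb]; split=> [t|].
  rewrite /ds_mul; apply: fiber_fsum => s.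
  by rewrite -{1}[t](mulVKg s); exact: fiber_mul.
apply: (sub_finite_set _ (finite_image2 (fun s t => s * t)%g fa fb)) => t /= h.
suff [s [a0 b0]] : exists s, a s != 0 /\ b (s^-1 * t)%g != 0.
  by exists s => //; exists (s^-1 * t)%g => //; rewrite mulVKg.
apply: contrapT => nex; move/negP: h; apply; apply/eqP.
rewrite /ds_mul; apply: fsbig1 => s _.
have [->|a0] := eqVneq (a s) 0; first by rewrite cmul0l.
have [->|b0] := eqVneq (b (s^-1 * t)%g) 0; first by rewrite cmul0r.
by exfalso; apply: nex; exists s.
Qed.

Lemma ds_mul_singlel s x a : ds_mul (single s x) a = fun t => x ** a (s^-1 * t)%g.
Proof.
apply: ds_ext => t; rewrite /ds_mul (fsum_single (t := s)) => [|u us].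
  by rewrite /single eqxx.
by rewrite /single (negPf us) cmul0l.
Qed.

Lemma ds_mul_singler x a : ds_mul a (single e x) = fun t => a t ** x.
Proof.
apply: ds_ext => t; rewrite /ds_mul (fsum_single (t := t)) => [|s st].
  by rewrite /single mulVg eqxx.
rewrite /single ifN ?cmul0r //; apply: contraNneq st => h.
by rewrite -[t](mulVKg s) h mulg1.
Qed.

Lemma ds_star_single t x : ds_star (single t x) = single (t^-1)%g (star x).
Proof.
apply: ds_ext => s; rewrite /ds_star /single -(inj_eq invg_inj) invgK.
by case: ifP => // _; rewrite star0.
Qed.

Lemma ds_mul_single11 x y : ds_mul (single e x) (single e y) = single e (x ** y).
Proof.
rewrite ds_mul_singlel; apply: ds_ext => t; rewrite /single invg1 mul1g.
by case: ifP => // _; rewrite cmul0r.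
Qed.

Lemma ds_star_mul_single t x :
  ds_mul (ds_star (single t x)) (single t x) = single e (star x ** x).
Proof.
rewrite ds_star_single ds_mul_singlel; apply: ds_ext => s; rewrite /single invgK.
rewrite -{2}[t]mulg1 (inj_eq (mulgI t)).
by case: ifP => // _; rewrite cmul0r.
Qed.

Lemma pos_sum (F : G -> A) (P : pred G) (r : seq G) :
  (forall s, pos (emb (F s) : U)) -> pos (emb (\sum_(s <- r | P s) F s) : U).
Proof.
move=> h; apply: (@big_ind A (fun x => pos (emb x : U))) => //.
  exact: pos0.
by move=> x y hx hy; rewrite embD; exact: posD.
Qed.

(** The value at the unit of a* a; it is the sum of the a_t* a_t. *)
Definition square_expectation a : A := ds_mul (ds_star a) a e.

Lemma square_expectationE a : square_expectation a =
  \sum_(s \in [set: G]) (star (a (s^-1)%g) ** a (s^-1)%g).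
Proof.
by rewrite /square_expectation /ds_mul; apply: eq_fsbigr => s _; rewrite mulg1.
Qed.

Lemma pos_square_expectation a : pos (emb (square_expectation a) : U).
Proof.
rewrite square_expectationE; apply: pos_sum => s; exact: pos_emb.
Qed.

(** a_t* a_t is one of the positive terms whose sum is [square_expectation]. *)
Lemma rnorm_fiber_le a t : direct_sum B a ->
  rnorm (a t) ^+ 2 <= rnorm (square_expectation a).
Proof.
move=> [Ba fa]; have [->|at0] := eqVneq (a t) 0.
  by rewrite rnorm0 expr0n rnorm_ge0.
rewrite square_expectationE -rnorm_star_cmul.
set F := fun s => star (a (s^-1)%g) ** a (s^-1)%g.
have Ft : F (t^-1)%g = star (a t) ** a t by rewrite /F invgK.
have fin : finite_set ([set: G] `&` F @^-1` [set~ 0]).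
  apply: (sub_finite_set _ (finite_image (fun t : G => t^-1)%g fa)) => s /= [_ Fs].
  exists (s^-1)%g; rewrite ?invgK //=; apply/eqP => a0.
  by apply: Fs; rewrite /F a0 cmul0r.
have tin : (t^-1)%g \in finite_support 0 [set: G] F.
  rewrite in_finite_support //; apply/mem_set; split => //=; rewrite Ft => h.
  move/eqP: at0; apply; apply: rnorm_eq0; apply/eqP.
  have := rnorm_star_cmul (a t); rewrite h rnorm0 => /esym/eqP.
  by rewrite expf_eq0.
rewrite (big_rem _ tin) /= -/F -[X in rnorm X <= _]Ft -!unorm_emb embD.
apply: unorm_le_addl; first exact: pos_emb.
by apply: pos_sum => s; exact: pos_emb.
Qed.

End DirectSum.

(** * Aperiodicity bounds the conditional expectation *)

Lemma sum_le_size (R : realType) (T : eqType) (F : T -> R) (r : seq T) d :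
  (forall t, t \in r -> F t <= d) -> \sum_(t <- r) F t <= (size r)%:R * d.
Proof.
elim: r => [|t r IH] h; first by rewrite big_nil mul0r.
rewrite big_cons /= -natr1 mulrDl mul1r addrC lerD ?h ?mem_head //.
by apply: IH => s sr; apply: h; rewrite inE sr orbT.
Qed.

Section Aperiodic.
Variables (R : realType) (G : groupType) (A : cstarAlgType R) (B : G -> set A).
Hypothesis hB : fell_bundle B.
Hypothesis hap : aperiodic B.
Local Notation e := (1%g : G).
Local Notation U := (unitization A).
Implicit Types (a b f : G -> A) (x y : A) (s t : G).

Let hBe : cstar_subalgebra (B e) := cstar_subalgebra_fiber1 hB.

(** The infimum of a set that is nonempty and bounded below is approached; a
nonzero hereditary subalgebra does contain positive elements of norm 1. *)
Lemma aperiodic_small t y D d : t != e -> B t y ->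
  hereditary_subalgebra D (B e) -> nonzero_set D -> 0 < d ->
  exists2 x, positive_in D x & rnorm x = 1 /\ rnorm (x ** y ** x) <= d.
Proof.
move=> te By hD D0 d0; have [hDs _ _] := hD.
have [x0 px0 x01] := nonzero_positive hDs D0.
have := hap te By hD D0; set E := (X in inf X) => infE.
have hE : has_inf E.
  split; last by exists 0 => _ [x _ <-]; exact: rnorm_ge0.
  exists (rnorm (x0 ** y ** x0)); exists x0 => //; split=> //.
  by rewrite rnormE x01.
have [_ [x [px x1] <-] lt] := inf_adherent d0 hE.
exists x => //; split; first by rewrite /rnorm x1.
by move: lt; rewrite infE add0r => /ltW.
Qed.

(** Aperiodicity provides an element x that works for one t; passing to the corner
of x keeps the estimate for all later choices, at the cost of a factor 16. *)
Lemma shrink b (r : seq G) D d : (forall t, B t (b t)) ->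
  hereditary_subalgebra D (B e) -> nonzero_set D -> 0 < d ->
  exists D', [/\ hereditary_subalgebra D' (B e), nonzero_set D', D' `<=` D
    & forall t, t \in r -> t != e -> forall x, D' x ->
        rnorm (x ** b t ** x) <= d * rnorm x ^+ 2].
Proof.
move=> Bb + + d0; elim: r D => [|t r IH] D hD D0; first by exists D; split.
have [te|te] := eqVneq t e.
  have [D' [h1 h2 h3 h4]] := IH D hD D0; exists D'; split=> // s.
  by rewrite inE => /orP[/eqP ->|]; [rewrite te eqxx | exact: h4].
have d16 : 0 < d / 16 by rewrite divr_gt0.
have [x px [x1 xb]] := aperiodic_small te (Bb t) hD D0 d16.
have [hDs _ _] := hD; have [Dx xx posx] := positive_in_sub hDs px.
have [D1 [hD1 D1D D10 hb _]] := corner_of hD Dx xx posx x1.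
have [D' [h1 h2 h3 h4]] := IH D1 hD1 D10; exists D'; split=> //.
  by move=> y /h3 /D1D.
move=> s; rewrite inE => /orP[/eqP ->|]; last exact: h4.
move=> _ y /h3 D1y; apply: (le_trans (hb _ _ D1y)).
rewrite ler_wpM2r ?exprn_ge0 ?rnorm_ge0 //; lra.
Qed.

Variable p : (G -> A) -> R.
Hypothesis p_ge0 : forall a, direct_sum B a -> 0 <= p a.
Hypothesis pZ : forall c a, direct_sum B a -> p (c *: a) = rnorm c * p a.
Hypothesis pD : forall a b, direct_sum B a -> direct_sum B b ->
  p (a + b) <= p a + p b.
Hypothesis pM : forall a b, direct_sum B a -> direct_sum B b ->
  p (ds_mul a b) <= p a * p b.
Hypothesis pC : forall a, direct_sum B a -> p (ds_mul (ds_star a) a) = p a ^+ 2.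
Hypothesis p_fiber_eq0 : forall x, B e x -> p (single e x) = 0 -> x = 0.

Lemma norm_single1 x : B e x -> p (single e x) = rnorm x.
Proof.
apply: (cstar_norm_unique hBe (p := fun y => p (single e y))) => //
  [y By|c y By|y z By Bz|y z By Bz|y By].
- by apply: p_ge0; exact: direct_sum_single.
- have -> : single e (c *: y) = c *: single e y.
    apply: ds_ext => t; rewrite -[RHS]/(c *: single e y t) /single.
    by case: ifP => // _; rewrite scaler0.
  by apply: pZ; exact: direct_sum_single.
- have -> : single e (y + z) = single e y + single e z.
    apply: ds_ext => t; rewrite -[RHS]/(single e y t + single e z t) /single.
    by case: ifP => // _; rewrite addr0.
  by apply: pD; exact: direct_sum_single.
- by rewrite -ds_mul_single11; apply: pM; exact: direct_sum_single.
- by rewrite -(ds_star_mul_single e) pC //; exact: direct_sum_single.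
Qed.

(** The C*-identity reduces any fibre to the unit fibre, where C*-norms are
unique. *)
Lemma norm_single t x : B t x -> p (single t x) = rnorm x.
Proof.
move=> Bx; have : p (single t x) ^+ 2 = rnorm x ^+ 2.
  rewrite -pC; last exact: direct_sum_single.
  rewrite ds_star_mul_single norm_single1 ?rnorm_star_cmul //.
  by rewrite -[e](mulVg t); apply: fiber_mul => //; exact: fiber_star.
apply: pexpIrn; rewrite ?nnegrE ?rnorm_ge0 ?p_ge0 //; exact: direct_sum_single.
Qed.

Definition erase t f : G -> A := fun s => if s == t then 0 else f s.

Lemma direct_sum_erase t f : direct_sum B f -> direct_sum B (erase t f).
Proof.
move=> [Bf ff]; split=> [s|].
  rewrite /erase; case: ifP => // _; apply: closed_subspace0; by case: hB.
by apply: (sub_finite_set _ ff) => s /=; rewrite /erase; case: ifP; rewrite ?eqxx.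
Qed.

Lemma eraseE t f : f = single t (f t) + erase t f.
Proof.
apply: ds_ext => s; rewrite -[RHS]/(single t (f t) s + erase t f s).
rewrite /single /erase; case: eqP => [->|_]; by rewrite ?addr0 ?add0r.
Qed.

Lemma norm_le_sum f (r : seq G) : direct_sum B f -> (forall t, t \notin r -> f t = 0) ->
  p f <= \sum_(t <- r) rnorm (f t).
Proof.
elim: r f => [|t r IH] f df f0.
  have -> : f = 0 *: f by apply: ds_ext => s; rewrite f0 // -[RHS]/(0 *: f s) scale0r.
  by rewrite big_nil pZ // rnorm0 mul0r.
rewrite big_cons {1}(eraseE t f); have de := direct_sum_erase t df.
have Bft : B t (f t) by case: df.
apply: (le_trans (pD (direct_sum_single hB Bft) de)).
rewrite norm_single // lerD2l; apply: (le_trans (IH _ de _)).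
  move=> s sr; rewrite /erase; case: eqP => // /eqP st.
  by apply: f0; rewrite inE negb_or st.
apply: ler_sum => s _; rewrite /erase; case: ifP => // _.
by rewrite rnorm0 rnorm_ge0.
Qed.

(** Compress b by x.  The terms of the compression other than the one at the unit
contribute at most d each. *)
Lemma rnorm_compress_le b x d (r : seq G) : direct_sum B b ->
  (forall t, t \notin r -> b t = 0) -> B e x -> rnorm x = 1 -> 0 <= d ->
  (forall t, t \in r -> t != e -> rnorm (x ** b t ** x) <= d) ->
  rnorm (x ** b e ** x) <= p b + (size r)%:R * d.
Proof.
move=> db br Bx x1 d0 small.
have dx : direct_sum B (single e x) by exact: direct_sum_single.
pose f := ds_mul (ds_mul (single e x) b) (single e x).
have fE t : f t = x ** b t ** x.
  by rewrite /f ds_mul_singler ds_mul_singlel invg1 mul1g.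
have df : direct_sum B f by apply: direct_sum_mul => //; exact: direct_sum_mul.
have pf : p f <= p b.
  have px : p (single e x) = 1 by rewrite norm_single1.
  apply: (le_trans (pM (direct_sum_mul hB dx db) dx)); rewrite px mulr1.
  by apply: (le_trans (pM dx db)); rewrite px mul1r.
have de := direct_sum_erase e df.
have pe : p (erase e f) <= (size r)%:R * d.
  apply: (le_trans (norm_le_sum (r := r) de _)).
    move=> t tr; rewrite /erase; case: ifP => // _.
    by rewrite fE br // cmul0r cmul0l.
  apply: sum_le_size => t tr; rewrite /erase; case: eqP => [_|/eqP te].
    by rewrite rnorm0.
  by rewrite fE small.
have Bfe : B e (f e) by case: df.
rewrite -fE -(norm_single1 Bfe).
have -> : single e (f e) = f + (-1) *: erase e f.
  by rewrite {2}(eraseE e f) scaleN1r addrK.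
apply: (le_trans (pD df (direct_sumZ hB (-1) de))).
by rewrite pZ // rnormN rnorm1 mul1r lerD.
Qed.

(** Let c = E(a* a) and h = c / |c|.  On the corner of h one has |x| <= 4 |h x|, and
|h x|^2 <= |x h x|, so |x c x| >= |c| / 16 for x self-adjoint of norm 1.  Inside
that corner [shrink] makes the remaining terms negligible. *)
Lemma square_expectation_le16 a : direct_sum B a ->
  rnorm (square_expectation a) <= 16 * p a ^+ 2.
Proof.
move=> da; set b := ds_mul (ds_star a) a.
have db : direct_sum B b by apply: direct_sum_mul => //; exact: direct_sum_star.
rewrite -pC // -/b -[square_expectation a]/(b e); set c := b e.
have [c0|cn] := eqVneq (rnorm c) 0; first by rewrite c0 mulr_ge0 ?p_ge0.
have cp : 0 < rnorm c by rewrite lt_def cn rnorm_ge0.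
have complex_gt0 : pos (emb c : U) by exact: pos_square_expectation.
have Bc : B e c by case: db.
set h := ((rnorm c)^-1)%:C *: c.
have posh : pos (emb h : U) by rewrite embZ; apply: pos_scale; rewrite ?invr_ge0 ?rnorm_ge0.
have hh : star h = h by apply: (@emb_inj R A); rewrite -adj_emb pos_sa.
have h1 : rnorm h = 1 by rewrite rnormZ rnorm_real ger0_norm ?invr_ge0 ?rnorm_ge0 // mulVf.
have Bh : B e h by apply: closed_subspaceZ => //; case: hBe.
have cE : c = (rnorm c)%:C *: h by rewrite scalerA -rmorphM /= divff // scale1r.
have [D [hD DB D0 _ hlow]] := corner_of (hereditary_self hBe) Bh hh posh h1.
pose r : seq G := fset_set [set t | b t != 0].
have fb : finite_set [set t | b t != 0] by case: db.
have br t : t \notin r -> b t = 0.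
  by rewrite in_fset_set // notin_setE /= => /negP; rewrite negbK => /eqP.
apply: le_addgt0 => d d0.
have s0 : 0 < 16 * (size r).+1%:R :> R by rewrite mulr_gt0.
have [D' [hD' D'0 D'D small]] := shrink r db.1 hD D0 (divr_gt0 d0 s0).
have [hD's D'B _] := hD'.
have [x px x1] := nonzero_positive hD's D'0.
have [D'x xx _] := positive_in_sub hD's px.
have xlow : 1 <= 4 * rnorm (h ** x) by rewrite -{1}x1; apply: hlow; exact: D'D.
have [k [kk /pos_sa ka _]] := pos_sqrt posh.
have hx2 : rnorm (h ** x) ^+ 2 <= rnorm (x ** h ** x).
  have -> : rnorm (h ** x) = unorm (k * (k * emb x) : U).
    by rewrite mulrA kk embM unorm_emb.
  have -> : rnorm (x ** h ** x) = unorm (k * emb x : U) ^+ 2.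
    rewrite -unorm_cstar adjM ka adj_emb xx -mulrA (mulrA k k) kk.
    by rewrite !embM cmulA unorm_emb.
  have k1 : unorm k = 1.
    have : unorm k ^+ 2 = 1 by rewrite -unorm_sa // kk unorm_emb.
    by move/eqP; rewrite sqrp_eq1 ?unorm_ge0 // => /eqP.
  rewrite lerXn2r ?nnegrE ?unorm_ge0 //; apply: (le_trans (unormM _ _)).
  by rewrite k1 mul1r.
have := rnorm_compress_le db br (D'B _ D'x) x1 (ltW (divr_gt0 d0 s0)).
have sm t : t \in r -> t != e -> rnorm (x ** b t ** x) <= d / (16 * (size r).+1%:R).
  by move=> tr te; have := small t tr te x D'x; rewrite x1 expr1n mulr1.
move=> /(_ sm); rewrite -/c {1}cE cmulZr cmulZl rnormZ rnorm_real ger0_norm ?rnorm_ge0 //.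
have : (size r)%:R * (d / (16 * (size r).+1%:R)) <= d / 16.
  rewrite invfM mulrA mulrA [_ * d]mulrC -!mulrA ler_wpM2l ?(ltW d0) //.
  rewrite mulrCA ler_piMr ?invr_ge0 // ler_pdivrMr // mul1r ler_nat //.
have : 1 <= 16 * rnorm (x ** h ** x).
  have := exprn_ege1 2 xlow; rewrite exprMn -natrX => /le_trans; apply.
  by rewrite ler_wpM2l.
move=> q1 q2 q3.
have := ler_wpM2l (rnorm_ge0 c) q1; rewrite mulr1 mulrCA => q4.
have {q2 q3} q5 := le_trans q3 (lerD (lexx (p b)) q2).
by move: (rnorm c * _) q4 q5 => u q4 q5; lra.
Qed.

(** The expectation satisfies |E(a)|^2 <= |E(a* a)|, so the constant in the
previous lemma disappears by iterated squares. *)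
Lemma expectation_contractive a : direct_sum B a -> rnorm (a e) <= p a.
Proof.
apply: (@le_of_squares R _ (direct_sum B) (fun a => ds_mul (ds_star a) a)
  (fun a => rnorm (a e)) p 4) => //.
- by move=> b db; apply: direct_sum_mul => //; exact: direct_sum_star.
- by move=> b _; exact: rnorm_ge0.
- by move=> b; exact: rnorm_fiber_le.
move=> b db; rewrite -(@ler_sqr _ (rnorm _)) ?nnegrE ?rnorm_ge0 ?mulr_ge0 ?p_ge0 //.
apply: (le_trans (rnorm_fiber_le e db)).
apply: (le_trans (square_expectation_le16 db)).
by rewrite exprMn -natrX.
Qed.

End Aperiodic.

(** * Quotients by an ideal *)

Section Quotient.
Variables (R : realType) (C : cstarAlgType R) (J : set C).
Hypothesis hJ : cstar_ideal J.
Local Notation U := (unitization C).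
Implicit Types (x y j : C).

Definition quotient_norm x : R := inf [set rnorm (x + j) | j in J].

Let Js : closed_subspace J. Proof. by case: hJ. Qed.

Lemma quotient_norm_le x j : J j -> quotient_norm x <= rnorm (x + j).
Proof.
move=> Jj; apply: ge_inf; last by exists j.
by exists 0 => _ [k _ <-]; exact: rnorm_ge0.
Qed.

Lemma quotient_norm_adherent x e : 0 < e -> 
  exists2 j, J j & rnorm (x + j) <= quotient_norm x + e.
Proof.
move=> e0; have hE : has_inf [set rnorm (x + j) | j in J].
  split; last by exists 0 => _ [k _ <-]; exact: rnorm_ge0.
  by exists (rnorm (x + 0)); exists 0 => //; exact: closed_subspace0.
have [_ [j Jj <-] /ltW h] := inf_adherent e0 hE.
by exists j.
Qed.

Lemma quotient_norm_ge0 x : 0 <= quotient_norm x.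
Proof.
apply: le_addgt0 => e e0; have [j _ h] := quotient_norm_adherent x e0.
exact: le_trans (rnorm_ge0 _) h.
Qed.

Lemma quotient_norm_le_rnorm x : quotient_norm x <= rnorm x.
Proof. by rewrite -{2}(addr0 x); apply: quotient_norm_le; exact: closed_subspace0. Qed.

Lemma quotient_norm_eq0 x : quotient_norm x = 0 -> J x.
Proof.
move=> x0; have /closed_subspaceP[_ _ Jc] := Js; apply: Jc => e e0.
have [j Jj h] := quotient_norm_adherent x e0; exists (- j); first exact: closed_subspaceN.
by move: h; rewrite x0 add0r opprK.
Qed.

Lemma quotient_normD x y : quotient_norm (x + y) <= quotient_norm x + quotient_norm y.
Proof.
apply: le_addgt0 => e e0; have e2 : 0 < e / 2 by rewrite divr_gt0.
have [j Jj hj] := quotient_norm_adherent x e2; have [k Jk hk] := quotient_norm_adherent y e2.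
have := quotient_norm_le (x + y) (closed_subspaceD Js Jj Jk).
rewrite addrACA; have := rnormD (x + j) (y + k); lra.
Qed.

Lemma quotient_normZ (c : R[i]) x : quotient_norm (c *: x) = rnorm c * quotient_norm x.
Proof.
have le d y : quotient_norm (d *: y) <= rnorm d * quotient_norm y.
  apply: le_addgt0 => e e0.
  have dp : 0 < rnorm d + 1 by rewrite ltr_wpDl ?rnorm_ge0.
  have [j Jj hj] := quotient_norm_adherent y (divr_gt0 e0 dp).
  have := quotient_norm_le (d *: y) (closed_subspaceZ Js d Jj).
  rewrite -scalerDr rnormZ; have := ler_wpM2l (rnorm_ge0 d) hj.
  have : (rnorm d + 1) * (e / (rnorm d + 1)) = e by rewrite mulrC divfK // lt0r_neq0.
  have := divr_gt0 e0 dp; move: (e / _) => s; nra.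
apply/le_anti; rewrite le /=.
have [->|c0] := eqVneq c 0; first by rewrite rnorm0 mul0r quotient_norm_ge0.
rewrite -{1}(scalerK c0 x).
apply: (le_trans (ler_wpM2l (rnorm_ge0 _) (le _ _))).
by rewrite mulrA -rnormM divff // rnorm1 mul1r.
Qed.

Lemma quotient_normM x y : quotient_norm (x ** y) <= quotient_norm x * quotient_norm y.
Proof.
have [_ JL JR] := hJ.
have key s t : quotient_norm x < s -> quotient_norm y < t -> quotient_norm (x ** y) <= s * t.
  rewrite -subr_gt0 => xs; rewrite -subr_gt0 => yt.
  have [j Jj] := quotient_norm_adherent x xs; rewrite [quotient_norm x + _]addrC subrK => hj.
  have [k Jk] := quotient_norm_adherent y yt; rewrite [quotient_norm y + _]addrC subrK => hk.
  have Jm : J (x ** k + j ** (y + k)).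
    by apply: closed_subspaceD => //; [exact: JL | exact: JR].
  apply: (le_trans (quotient_norm_le _ Jm)).
  rewrite addrA -cmulDr -cmulDl; apply: (le_trans (rnorm_cmul _ _)).
  by rewrite ler_pM ?rnorm_ge0.
apply: le_addgt0 => e e0.
have x0 := quotient_norm_ge0 x; have y0 := quotient_norm_ge0 y.
have sp : 0 < quotient_norm x + quotient_norm y + 1 + e by lra.
set d := e / (quotient_norm x + quotient_norm y + 1 + e); have dp : 0 < d by rewrite divr_gt0.
have dE : d * (quotient_norm x + quotient_norm y + 1 + e) = e by rewrite divfK // lt0r_neq0.
have d1 : d < 1 by rewrite ltr_pdivrMr //; lra.
have := @key (quotient_norm x + d) (quotient_norm y + d); rewrite !ltrDl => /(_ dp dp).
by move: (quotient_norm x) (quotient_norm y) x0 y0 dE => s t s0 t0 dE; nra.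
Qed.

(** Expanding the power leaves 1 and terms divisible by j. *)
Lemma approx_unit_in_ideal j t n : J j ->
  exists2 u, J u & (1 - t%:C *: (adj (emb j) * emb j)) ^+ n = 1 + emb u :> U.
Proof.
have [_ JL JR] := hJ; move=> Jj.
rewrite adj_emb embM -embZ; set c := _ *: _.
have Jc : J c by apply: closed_subspaceZ => //; exact: JL.
elim: n => [|n [u Ju IH]].
  by exists 0; [exact: closed_subspace0 | rewrite expr0 emb0 addr0].
exists (u - (c + c ** u)).
  apply: closed_subspaceD => //; apply: closed_subspaceN => //.
  by apply: closed_subspaceD => //; exact: JL.
rewrite exprS IH mulrBl mul1r mulrDr mulr1 embM embD embN embD.
by rewrite addrA.
Qed.

(** Given j in J with |x* x + j| close to the quotient norm of x* x, choose d in
1 + J, a self-adjoint contraction with j d small.  Then x d represents the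
class of x, and |x d|^2 = |d x* x d| is close to |d (x* x + j) d|. *)
Lemma quotient_norm_sq_le x : quotient_norm x ^+ 2 <= quotient_norm (star x ** x).
Proof.
have [_ JL JR] := hJ; apply: le_addgt0 => e e0.
have e2 : 0 < e / 2 by rewrite divr_gt0.
have [j Jj hj] := quotient_norm_adherent (star x ** x) e2.
have [t [n [da d1 jd]]] := approx_unit (emb j : U) e2.
have [u Ju dE] := approx_unit_in_ideal t n Jj.
set d := (_ ^+ n) in da d1 jd dE.
have h1 : quotient_norm x <= unorm (emb x * d).
  have -> : emb x * d = emb (x + x ** u) by rewrite dE mulrDr mulr1 embM embD.
  by rewrite unorm_emb; apply: quotient_norm_le; exact: JL.
have h2 : unorm (emb x * d) ^+ 2 <= rnorm (star x ** x + j) + e / 2.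
  have -> : unorm (emb x * d) ^+ 2 = unorm (d * (emb (star x ** x) * d)).
    by rewrite -unorm_cstar adjM da adj_emb -mulrA (mulrA (emb (star x))) embM.
  have -> : emb (star x ** x) * d =
      emb (star x ** x + j) * d - emb j * d by rewrite embD mulrDl addrK.
  rewrite mulrBr; apply: (le_trans (unormD _ _)); rewrite unormN.
  have d0 := unorm_ge0 d.
  apply: lerD.
    apply: (le_trans (unormM _ _)); apply: (le_trans (ler_piMl (unorm_ge0 _) d1)).
    apply: (le_trans (unormM _ _)); rewrite unorm_emb.
    by rewrite ler_piMr ?rnorm_ge0.
  apply: (le_trans (unormM _ _)); apply: le_trans jd.
  by rewrite ler_piMl ?unorm_ge0.
have : quotient_norm x ^+ 2 <= unorm (emb x * d) ^+ 2.
  by rewrite lerXn2r ?nnegrE ?quotient_norm_ge0 ?unorm_ge0.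
lra.
Qed.

(** The inequality just proved yields |star y| = |y| in the quotient, as in any
C*-algebra, hence the reverse inequality. *)
Lemma quotient_normC x : quotient_norm (star x ** x) = quotient_norm x ^+ 2.
Proof.
have le y : quotient_norm y <= quotient_norm (star y).
  have [->|y0] := eqVneq (quotient_norm y) 0; first exact: quotient_norm_ge0.
  have yp : 0 < quotient_norm y by rewrite lt_def y0 quotient_norm_ge0.
  rewrite -(ler_pM2r yp) -expr2; apply: (le_trans (quotient_norm_sq_le y)).
  exact: quotient_normM.
apply/le_anti; rewrite quotient_norm_sq_le andbT; apply: (le_trans (quotient_normM _ _)).
by rewrite expr2 ler_wpM2r ?quotient_norm_ge0 // -{2}(starK x) le.
Qed.

End Quotient.

(** * The intersection property *)

Theorem corollary4p3 (R : realType) (G : groupType) (A : cstarAlgType R)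
    (B : G -> set A) (hB : fell_bundle B) (hap : aperiodic B)
    (C : cstarAlgType R) (iota : (G -> A) -> C)
    (hC : reduced_cross_sectional_algebra B iota) :
  intersection_property B iota.
Proof.
move=> J hJ [j Jj j0]; apply: contrapT => disjoint.
have [N [[[[N0 N_eq0 _ _] _] _] Nmin] [iotaL iotaM iotaS iotaN iotaD]] := hC.
have ds0 : direct_sum B 0.
  rewrite -(scale0r (single 1%g (0 : A))); apply: direct_sumZ => //.
  by apply: direct_sum_single => //; apply: closed_subspace0; case: hB.
have iota0 : iota 0 = 0.
  have := iotaL 1 0 0 ds0 ds0; rewrite !scale1r addr0 => h.
  by apply: (addrI (iota 0)); rewrite addr0 -h.
have iotaZ c a : direct_sum B a -> iota (c *: a) = c *: iota a.
  by move=> da; have := iotaL c a 0 da ds0; rewrite iota0 !addr0.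
have iotaA a b : direct_sum B a -> direct_sum B b ->
    iota (a + b) = iota a + iota b.
  by move=> da db; have := iotaL 1 a b da db; rewrite !scale1r.
(* The quotient norm, pulled back to the direct sum. *)
pose p a := quotient_norm J (iota a).
have p_ge0 a : direct_sum B a -> 0 <= p a by move=> _; exact: quotient_norm_ge0.
have pZ c a : direct_sum B a -> p (c *: a) = rnorm c * p a.
  by move=> da; rewrite /p iotaZ // quotient_normZ.
have pD a b : direct_sum B a -> direct_sum B b -> p (a + b) <= p a + p b.
  by move=> da db; rewrite /p iotaA // quotient_normD.
have pM a b : direct_sum B a -> direct_sum B b -> p (ds_mul a b) <= p a * p b.
  by move=> da db; rewrite /p iotaM // quotient_normM.
have pC a : direct_sum B a -> p (ds_mul (ds_star a) a) = p a ^+ 2.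
  move=> da; have dsa := direct_sum_star hB da.
  by rewrite /p iotaM // iotaS // quotient_normC.
have p_fiber_eq0 x : B 1%g x -> p (single 1%g x) = 0 -> x = 0.
  move=> Bx /(quotient_norm_eq0 hJ) Jx; have dx := direct_sum_single hB Bx.
  have ix0 : iota (single 1%g x) = 0.
    apply: contrapT => /eqP ix; apply: disjoint.
    by exists (iota (single 1%g x)) => //; split=> //; exists x.
  have /(N_eq0 _ dx) s0 : N (single 1%g x) = 0 by rewrite -iotaN // ix0 normr0.
  by have := congr1 (fun f => f 1%g) s0; rewrite /single eqxx.
have Ep a : direct_sum B a -> rnorm (a 1%g) <= p a.
  by apply: expectation_contractive.
pose N' a : R[i] := (p a)%:C.
have N'top : topological_grading_norm B N'.
  split; last by move=> a da; rewrite rnormE lecR; exact: Ep.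
  split; first split.
  - by move=> a da; rewrite ler0c p_ge0.
  - move=> a da /(@complexI R) pa0; apply: ds_ext => t.
    apply: rnorm_eq0.
    have := rnorm_fiber_le t da.
    have := Ep _ (direct_sum_mul hB (direct_sum_star hB da) da).
    rewrite pC // pa0 expr0n /= => h1 h2.
    have : rnorm (a t) ^+ 2 == 0.
      by rewrite eq_le exprn_ge0 ?rnorm_ge0 // andbT; exact: le_trans h1.
    by rewrite expf_eq0 /= => /eqP.
  - by move=> c a da; rewrite /N' pZ // rnormE -rmorphM.
  - by move=> a b da db; rewrite /N' -rmorphD /= lecR pD.
  split=> [a b da db|a da]; first by rewrite /N' -rmorphM /= lecR pM.
  by rewrite /N' pC // rmorphXn.
have N'N a : direct_sum B a -> N' a <= N a.
  by move=> da; rewrite -iotaN // rnormE lecR quotient_norm_le_rnorm.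
(* Minimality of the reduced norm: the quotient map is isometric on the image of
   iota, so elements of J, which can be approximated there, have norm 0. *)
have isom a : direct_sum B a -> p a = rnorm (iota a).
  move=> da; have := Nmin N' N'top N'N a da.
  by rewrite -iotaN // rnormE => /(@complexI R).
move/eqP: j0; apply; apply: rnorm_eq0; apply/le_anti; rewrite rnorm_ge0 andbT.
apply: le_addgt0 => e e0; rewrite add0r.
have e2 : 0 < e / 2 by rewrite divr_gt0.
have [_ [a da <-] ja] : exists2 y, (iota @` direct_sum B) y & rnorm (j - y) <= e / 2.
  by apply: closure_adherent => //; rewrite iotaD.
have : rnorm (iota a) <= rnorm (iota a - j).
  rewrite -isom //; apply: quotient_norm_le => //; apply: closed_subspaceN => //.
  by case: hJ.
have := rnormD (j - iota a) (iota a); rewrite subrK (rnormB (iota a)); lra.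
Qed.
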